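(* For every real $p$ with $1 < p < \infty$ there exist constants $\epsilon_p > 0$ and $C_p > 0$, depending only on $p$, such that the following holds for every integer $N \geq 1$. Let $L \subset \{0,1\}^N$ have relative density $\epsilon_L := |L| / 2^N$ satisfying $\epsilon_L \leq \epsilon_p$. Then there exists $z = z_L \in \{0,1\}^N$ such that for every integer $0 \leq k \leq N$, \[ \frac{|\{x \in L : |x - z_L| = k\}|}{|\{x \in \{0,1\}^N : |x - z_L| = k\}|} \leq C_p \, \epsilon_L^{1/p}. \]
   Context: $\{0,1\}^N$ is the $N$-dimensional hypercube, viewed as the group $(\mathbb{Z}/2\mathbb{Z})^N$ (subtraction is componentwise mod 2), and for $y \in \{0,1\}^N$, $|y| := \#\{1 \leq i \leq N : y(i) = 1\}$. For a finite set $E$, $|E|$ denotes its cardinality. *)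

(* Defs.v *)
From mathcomp Require Import all_boot all_order all_algebra.
From mathcomp Require Import all_classical all_reals all_analysis.

Set Implicit Arguments.
Unset Strict Implicit.
Unset Printing Implicit Defensive.

Import Order.TTheory GRing.Theory Num.Theory.
Local Open Scope ring_scope.

(* The additive group of row vectors over 'F_2 is (Z/2Z)^N, so [x - z] below is
   the componentwise difference mod 2. *)
Definition hypercube (N : nat) := 'rV['F_2]_N.

Definition hweight (N : nat) (y : hypercube N) : nat :=
  #|[set i : 'I_N | y ord0 i == 1]|.

Definition sphere (N : nat) (z : hypercube N) (k : nat) : {set hypercube N} :=
  [set x : hypercube N | hweight (x - z) == k].

Definition reldensity (R : realType) (N : nat) (L : {set hypercube N}) : R :=
  #|L|%:R / 2 ^+ N.

(* Main.v *)
Require Import Defs.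
From mathcomp Require Import all_boot all_order all_algebra.
From mathcomp Require Import all_classical all_reals all_analysis.
From mathcomp Require Import ring lra zify.

Import Order.TTheory GRing.Theory Num.Theory.
Local Open Scope ring_scope.

(* Let f be the indicator of L, with density e, let A_k f be its averages over
   spheres of radius k, and put l = e^(1/p), d = e^(1-1/p), so that d l = e. The
   antipodal map reduces the claim to k <= N/2, and there it is enough that the
   set of z with A_k f(z) > C l for some k has density below 1/2.
   - For k < 1/d, Markov's inequality applies to the sum of these A_k f.
   - For k >= 1/d, let T be the average of A_j f over a window of h ~ d k radii
     j = k, k-2, k-4, ... and write A_k f = (1 - (1-T)^M) A_k f + (1-T)^M A_k f.
     The first term is at most (2^M / h) sum_(j <= k) A_j f. Up to N/8 the sums
     k^-1 sum_(j <= k) A_j f are dominated by ergodic averages of the nearest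
     neighbour walk, so Hopf's maximal inequality is a weak-type (1,1) bound for
     them; above N/8 a single average dominates. The first term is O(e/d) = O(l).
   - The second term is controlled by the M-th differences (in steps of 2) of
     k |-> A_k f. Its square is at most a constant times d^(2M-1) times the
     square function sum_j j^(2M-1) |D^M A_j f|^2, which is bounded on L^2 because
     the normalized Krawtchouk polynomials satisfy an exact difference identity
     and decay exponentially. This gives O(d^(2M-1) e) = O(d^(2M) l), and M is
     chosen so large that d^(2M) <= l. *)

(** * Krawtchouk polynomials: recurrences and the difference identity *)

(* The average of (-1)^|T n S| over the k-subsets T of a set of a + b elements,
   where |S| = a: the normalized Krawtchouk polynomial. The recursion draws one
   element of T; the junk values are those with k > a + b. *)
Fixpoint kraw (R : realType) (k a b : nat) : R :=
  if k is k'.+1 then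
    (b%:R * kraw R k' a b.-1 - a%:R * kraw R k' a.-1 b) / (a + b)%:R
  else 1.

Lemma krawS (R : realType) (k a b : nat) :
  (a + b)%:R * kraw R k.+1 a b = b%:R * kraw R k a b.-1 - a%:R * kraw R k a.-1 b.
Proof.
rewrite /=; case: (posnP (a + b)) => [/eqP|ab0].
  by rewrite addn_eq0 => /andP[/eqP-> /eqP->]; rewrite !mul0r subrr.
by rewrite mulrCA divff ?mulr1 // pnatr_eq0 -lt0n.
Qed.

(** Average over a random element outside T, which exists as [k < a + b]: once it is removed, T is
    uniform in the rest. Where [b.-1] or [a.-1] is truncated, its coefficient is 0. *)
Lemma kraw_pascal (R : realType) (k a b : nat) : (k < a + b)%N ->
  (a + b)%:R * kraw R k a b = b%:R * kraw R k a b.-1 + a%:R * kraw R k a.-1 b.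
Proof.
elim: k a b => [|k IH] a b kab; first by rewrite /= !mulr1 natrD addrC.
have N1 : (a + b).-1%:R != 0 :> R by rewrite pnatr_eq0; lia.
apply: (mulfI N1).
have Sb : (a + b).-1%:R * (b%:R * kraw R k.+1 a b.-1)
    = b%:R * (b.-1%:R * kraw R k a b.-2 - a%:R * kraw R k a.-1 b.-1) :> R.
  case: b {N1} kab => [|b] kab; first by rewrite !mul0r mulr0.
  by rewrite mulrCA addnS /= krawS.
have Sa : (a + b).-1%:R * (a%:R * kraw R k.+1 a.-1 b)
    = a%:R * (b%:R * kraw R k a.-1 b.-1 - a.-1%:R * kraw R k a.-2 b) :> R.
  case: a {N1 Sb} kab => [|a] kab; first by rewrite !mul0r mulr0.
  by rewrite mulrCA addSn /= krawS.
have Pb : (a + b).-1%:R * (b%:R * kraw R k a b.-1)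
    = b%:R * (b.-1%:R * kraw R k a b.-2 + a%:R * kraw R k a.-1 b.-1) :> R.
  case: b {N1 Sa Sb} kab => [|b] kab; first by rewrite !mul0r mulr0.
  by rewrite mulrCA addnS /= IH //; lia.
have Pa : (a + b).-1%:R * (a%:R * kraw R k a.-1 b)
    = a%:R * (b%:R * kraw R k a.-1 b.-1 + a.-1%:R * kraw R k a.-2 b) :> R.
  case: a {N1 Sa Sb Pb} kab => [|a] kab; first by rewrite !mul0r mulr0.
  by rewrite mulrCA addSn /= IH //; lia.
by rewrite krawS mulrBr mulrDr Sb Sa Pb Pa; ring.
Qed.

(** The number b - a is the sum over all i of a sign, -1 on S and +1 off S. Multiplying the sign of
    T by that of i toggles i in T: k choices of i shrink T and a + b - k enlarge it. *)
Lemma kraw_three_term (R : realType) (k a b : nat) : (k < a + b)%N ->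
  (b%:R - a%:R) * kraw R k a b
    = k%:R * kraw R k.-1 a b + (a + b - k)%:R * kraw R k.+1 a b.
Proof.
elim: k a b => [|k IH] a b kab.
  by rewrite subn0 krawS /= mul0r add0r !mulr1.
have N0 : (a + b)%:R != 0 :> R by rewrite pnatr_eq0; lia.
apply: (mulfI N0); rewrite succnK.
have Tb : b%:R * ((b%:R - 1 - a%:R) * kraw R k a b.-1)
  = b%:R * (k%:R * kraw R k.-1 a b.-1 + (a + b - k.+1)%:R * kraw R k.+1 a b.-1).
  case: b {N0} kab => [|b] kab; first by rewrite !mul0r.
  rewrite /= [b.+1%:R in X in _ * (X * _)]mulrSr addrK IH; last by lia.
  by congr (_ * (_ + _%:R * _)); lia.
have Ta : a%:R * ((b%:R - (a%:R - 1)) * kraw R k a.-1 b)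
  = a%:R * (k%:R * kraw R k.-1 a.-1 b + (a + b - k.+1)%:R * kraw R k.+1 a.-1 b).
  case: a {N0 Tb} kab => [|a] kab; first by rewrite !mul0r.
  rewrite /= [a.+1%:R in X in _ * (X * _)]mulrSr addrK IH; last by lia.
  by congr (_ * (_ + _%:R * _)); lia.
have Pk := kraw_pascal R k a b (ltnW kab).
have Sk := krawS R k a b.
have Sk1 := krawS R k.+1 a b.
have Skm : k%:R * ((a + b)%:R * kraw R k a b)
  = k%:R * (b%:R * kraw R k.-1 a b.-1 - a%:R * kraw R k.-1 a.-1 b) :> R.
  case: k {IH kab Tb Ta Pk Sk Sk1} => [|k]; first by rewrite !mul0r.
  by rewrite krawS.
rewrite [k.+1%:R]mulrSr.
transitivity ((b%:R - a%:R) * ((a + b)%:R * kraw R k.+1 a b)); first by ring.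
transitivity (k%:R * ((a + b)%:R * kraw R k a b) + (a + b)%:R * kraw R k a b +
  (a + b - k.+1)%:R * ((a + b)%:R * kraw R k.+2 a b)); last by ring.
rewrite Sk1 Skm Pk Sk.
transitivity (b%:R * ((b%:R - 1 - a%:R) * kraw R k a b.-1) + b%:R * kraw R k a b.-1
  - a%:R * ((b%:R - (a%:R - 1)) * kraw R k a.-1 b) + a%:R * kraw R k a.-1 b); first by ring.
by rewrite Tb Ta; ring.
Qed.

(* Draw a pair of elements and put a random one of the two into T: the
   contributions of the pairs split by S cancel. *)
Lemma kraw_pairs (R : realType) (k a b : nat) : (k.+1 < a + b)%N ->
  (a + b)%:R * (a + b).-1%:R * kraw R k.+1 a b
    = b%:R * b.-1%:R * kraw R k a b.-2 - a%:R * a.-1%:R * kraw R k a.-2 b.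
Proof.
move=> kab.
have Pb : (a + b).-1%:R * (b%:R * kraw R k a b.-1)
    = b%:R * (b.-1%:R * kraw R k a b.-2 + a%:R * kraw R k a.-1 b.-1) :> R.
  case: b kab => [|b] kab; first by rewrite !mul0r mulr0.
  by rewrite mulrCA addnS /= kraw_pascal //; lia.
have Pa : (a + b).-1%:R * (a%:R * kraw R k a.-1 b)
    = a%:R * (b%:R * kraw R k a.-1 b.-1 + a.-1%:R * kraw R k a.-2 b) :> R.
  case: a kab {Pb} => [|a] kab; first by rewrite !mul0r mulr0.
  by rewrite mulrCA addSn /= kraw_pascal //; lia.
by rewrite mulrAC krawS mulrC mulrBr Pb Pa; ring.
Qed.

(** Draw a pair outside a k-set T and compare adding both elements with adding none. The sign
    changes only if S splits the pair, which has probability 2ab / ((a+b)(a+b-1)); the contribution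
    is then -2 times an average with a - 1 and b - 1. *)
Lemma kraw_diff2 (R : realType) (k a b : nat) : (k.+1 < a + b)%N ->
  kraw R k.+2 a b - kraw R k a b
    = - 4 * (a%:R * b%:R / ((a + b)%:R * (a + b).-1%:R)) * kraw R k a.-1 b.-1.
Proof.
move=> kab.
have N0 : (a + b)%:R != 0 :> R by rewrite pnatr_eq0; lia.
have N1 : (a + b).-1%:R != 0 :> R by rewrite pnatr_eq0; lia.
have Pb : (a + b).-1%:R * (b%:R * kraw R k a b.-1)
    = b%:R * (b.-1%:R * kraw R k a b.-2 + a%:R * kraw R k a.-1 b.-1) :> R.
  case: b {N0 N1} kab => [|b] kab; first by rewrite !mul0r mulr0.
  by rewrite mulrCA addnS /= kraw_pascal //; lia.
have Pa : (a + b).-1%:R * (a%:R * kraw R k a.-1 b)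
    = a%:R * (b%:R * kraw R k a.-1 b.-1 + a.-1%:R * kraw R k a.-2 b) :> R.
  case: a {N0 N1} kab {Pb} => [|a] kab; first by rewrite !mul0r mulr0.
  by rewrite mulrCA addSn /= kraw_pascal //; lia.
have Sb : (a + b).-1%:R * (b%:R * kraw R k.+1 a b.-1)
    = b%:R * (b.-1%:R * kraw R k a b.-2 - a%:R * kraw R k a.-1 b.-1) :> R.
  case: b {N0 N1 Pa Pb} kab => [|b] kab; first by rewrite !mul0r mulr0.
  by rewrite mulrCA addnS /= krawS.
have Sa : (a + b).-1%:R * (a%:R * kraw R k.+1 a.-1 b)
    = a%:R * (b%:R * kraw R k a.-1 b.-1 - a.-1%:R * kraw R k a.-2 b) :> R.
  case: a {N0 N1 Pa Pb Sb} kab => [|a] kab; first by rewrite !mul0r mulr0.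
  by rewrite mulrCA addSn /= krawS.
apply: (mulfI (mulf_neq0 N1 N0)).
rewrite mulrBr -!mulrA krawS kraw_pascal; last exact: ltnW.
rewrite mulrBr mulrDr Sb Sa Pb Pa.
by field; rewrite -natrD N0 N1.
Qed.

(** * Maximal inequalities of Hopf and Markov *)

(** For linear [U] this is f + U f + ... + U^(n-1) f, in Horner form. *)
Definition ergodic_sum (R : realType) (T : Type) (U : (T -> R) -> T -> R)
    (f : T -> R) (n : nat) : T -> R :=
  iter n (fun g x => f x + U g x) (fun=> 0).

Lemma hopf_maximal (R : realType) (T : finType) (U : (T -> R) -> T -> R)
    (f : T -> R) (t : R) (n : nat) :
  (forall g h, (forall x, g x <= h x) -> forall x, U g x <= U h x) ->
  (forall x, U (fun=> 0) x = 0) ->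
  (forall g c x, U (fun y => g y - c) x = U g x - c) ->
  (forall g, \sum_x U g x = \sum_x g x) ->
  (forall x, 0 <= f x) ->
  #|[set x | [exists i : 'I_n.+1, i%:R * t < ergodic_sum R T U f i x]]|%:R * t
    <= \sum_x f x.
Proof.
move=> Umono Uzero Ucst Usum f0.
(* Garsia's argument, with the positive parts of the running maxima of the
   ergodic sums of f - t replaced by the recursively defined majorant F. *)
pose F := fix F i x := if i is i'.+1 then Num.max 0 (f x - t + U (F i') x) else 0.
have F0 i x : 0 <= F i x by case: i => [|i] //=; rewrite le_max lexx.
have U0 i x : 0 <= U (F i) x by rewrite -(Uzero x); apply: Umono => y; exact: F0.
have Fmono i x : F i x <= F i.+1 x.
  elim: i x => [|i IH] x; first exact: F0.
  by rewrite [F i.+1 x]/= ge_max F0 /= le_max lerD2l (Umono _ _ IH) orbT.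
have FS i x : ergodic_sum R T U f i x - i%:R * t <= F i x.
  elim: i x => [|i IH] x; first by rewrite /= mul0r subr0.
  rewrite /= le_max; apply/orP; right.
  have -> : f x + U (ergodic_sum R T U f i) x - i.+1%:R * t =
      f x - t + (U (ergodic_sum R T U f i) x - i%:R * t) by rewrite mulrSr; ring.
  by rewrite lerD2l -Ucst; apply: Umono.
have Fle i x : (i <= n)%N -> F i x <= F n x.
  move=> /subnK <-; elim: (n - i)%N => [//|j IH].
  by rewrite addSn; apply: le_trans IH (Fmono _ _).
pose E := [set x | 0 < F n x].
(* Where [F m] is positive, its maximum is the second term, and monotonicity of [F] in the index
   closes the gap. *)
have EF m x : 0 < F m x -> F m x - U (F m) x <= f x - t.
  rewrite lerBlDr; case: m => [|m]; first by rewrite ltxx.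
  rewrite [F m.+1 x]/= lt_max ltxx /= => P; rewrite max_r ?(ltW P) //.
  by rewrite lerD2l; apply: Umono => y; apply: Fmono.
(* [F n] and [U (F n)] have equal sums, and off [E] their difference is nonpositive, so on [E] it
   sums to something nonnegative. *)
have : \sum_(x in E) (f x - t) >= 0.
  apply: (@le_trans _ _ (\sum_x (F n x - U (F n) x))).
    by rewrite sumrB Usum subrr.
  rewrite (bigID (mem E)) /= -[leRHS]addr0 lerD //.
    by apply: ler_sum => x; rewrite inE; exact: EF.
  apply: sumr_le0 => x; rewrite inE -leNgt subr_le0 => Fx.
  exact: le_trans Fx (U0 _ _).
rewrite sumrB sumr_const subr_ge0 -[t *+ _]mulr_natl => Et.
have sE : [set x | [exists i : 'I_n.+1, i%:R * t < ergodic_sum R T U f i x]] \subset E.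
  apply/fintype.subsetP => x; rewrite !inE => /existsP[i P].
  apply: lt_le_trans (Fle i x _); last by rewrite -ltnS ltn_ord.
  by apply: lt_le_trans (FS i x); rewrite subr_gt0.
have sumE : \sum_(x in E) f x <= \sum_x f x.
  by rewrite [leRHS](bigID (mem E)) /= lerDl sumr_ge0.
apply: le_trans sumE; have [t0|t0] := leP 0 t.
  by apply: le_trans Et; apply: ler_wpM2r; rewrite // ler_nat subset_leq_card.
apply: (@le_trans _ _ 0); last exact: sumr_ge0.
by rewrite mulr_ge0_le0 // ltW.
Qed.

Lemma card_markov (R : realType) (T : finType) (g : T -> R) (t : R) :
  (forall x, 0 <= g x) -> #|[set x | t < g x]|%:R * t <= \sum_x g x.
Proof.
move=> g0; rewrite mulr_natl -sumr_const.
rewrite [leRHS](bigID (mem [set x | t < g x])) /= -[leLHS]addr0 lerD //.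
  by apply: ler_sum => x; rewrite inE => /ltW.
by apply: sumr_ge0.
Qed.

(** * Window averages and iterated differences of a sequence *)

(** This is 1 - T, with T the average over [h] consecutive indices. It is later applied to i |->
    A_(k-2i), so that one index is a step of 2 in the radius. *)
Definition window_gap (R : realType) (h : nat) (v : nat -> R) (i : nat) : R :=
  v i - (\sum_(j < h) v (i + j)%N) / h%:R.

Definition fdiff (R : realType) (v : nat -> R) (i : nat) : R := v i.+1 - v i.

Lemma double_window_sum (R : realType) (h n i : nat) (w : nat -> R) :
  (forall j, 0 <= w j) ->
  \sum_(j < h) \sum_(l < n) w (i + j + l)%N <= h%:R * \sum_(l < n + h) w (i + l)%N.
Proof.
move=> w0; rewrite mulr_natl -[X in _ *+ X]card_ord -sumr_const.
apply: ler_sum => j _.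
under eq_bigr do rewrite -addnA.
rewrite -(big_mkord xpredT (fun l => w (i + (j + l))%N)).
rewrite -(big_mkord xpredT (fun l => w (i + l)%N)).
have -> : \sum_(0 <= l < n) w (i + (j + l))%N = \sum_(j <= l < n + j) w (i + l)%N.
  rewrite -{2}[j : nat]add0n big_addn addnK.
  by apply: eq_bigr => l _; rewrite [(l + _)%N]addnC.
rewrite [leRHS](big_cat_nat (n := j)) //=; last by have := ltn_ord j; lia.
rewrite [X in _ <= _ + X](big_cat_nat (n := n + j)) //=; try by have := ltn_ord j; lia.
by rewrite addrCA lerDl addr_ge0 // sumr_ge0.
Qed.

(** 1 - (1 - T)^m is a polynomial in T without constant term whose coefficients have absolute sum
    2^m - 1, and every power T^j with 1 <= j <= m averages with weights at most 1/h over a window of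
    length at most m h. *)
Lemma window_gap_close (R : realType) (h m i : nat) (v : nat -> R) : (0 < h)%N ->
  `|v i - iter m (window_gap R h) v i|
    <= 2 ^+ m / h%:R * \sum_(l < m * h) `|v (i + l)%N|.
Proof.
move=> h0; have h0R : 0 < h%:R :> R by rewrite ltr0n.
(* The induction maps the constant c to 2c + 1, hence 2^m - 1 rather than 2^m. *)
suff: `|v i - iter m (window_gap R h) v i|
    <= (2 ^+ m - 1) / h%:R * \sum_(l < m * h) `|v (i + l)%N|.
  move=> /le_trans; apply; apply: ler_wpM2r; first exact: sumr_ge0.
  by rewrite ler_pM2r ?invr_gt0 // lerBlDr lerDl.
elim: m i => [|m IH] i; first by rewrite /= !subrr !mul0r normr0.
pose w := iter m (window_gap R h) v; pose W i := \sum_(l < m.+1 * h) `|v (i + l)%N|.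
have wle j : `|w j| <= `|v j| + (2 ^+ m - 1) / h%:R * \sum_(l < m * h) `|v (j + l)%N|.
  by rewrite -lerBlDl; apply: le_trans (IH j); rewrite distrC; exact: lerB_dist.
have m1 : 0 <= (2 ^+ m - 1) / h%:R :> R.
  by rewrite divr_ge0 ?ler0n // subr_ge0 exprn_ege1 // ler1n.
have sub a : (a <= m.+1 * h)%N -> \sum_(l < a) `|v (i + l)%N| <= W i.
  move=> am; rewrite /W -!(big_mkord xpredT (fun l => `|v (i + l)%N|)).
  by rewrite [leRHS](big_cat_nat (n := a)) //= lerDl sumr_ge0.
have avg : `|(\sum_(j < h) w (i + j)%N) / h%:R| <= 2 ^+ m / h%:R * W i.
  rewrite normrM [`|h%:R^-1|]ger0_norm ?invr_ge0 ?ler0n // mulrAC ler_pM2r ?invr_gt0 //.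
  apply: le_trans (ler_norm_sum _ _ _) _.
  apply: (@le_trans _ _ (\sum_(j < h) (`|v (i + j)%N| +
      (2 ^+ m - 1) / h%:R * \sum_(l < m * h) `|v (i + j + l)%N|))).
    by apply: ler_sum => j _; exact: wle.
  rewrite big_split /= -mulr_sumr.
  apply: (@le_trans _ _ (W i + (2 ^+ m - 1) / h%:R * (h%:R * W i))).
    apply: lerD; first by apply: sub; rewrite leq_pmull.
    rewrite ler_wpM2l // /W mulSnr.
    by apply: (double_window_sum R h (m * h) i (fun l => `|v l|)).
  by rewrite mulrA divfK ?gt_eqF //; lra.
have -> : v i - iter m.+1 (window_gap R h) v i
    = v i - w i + (\sum_(j < h) w (i + j)%N) / h%:R.
  by rewrite iterS /window_gap -/w; ring.
apply: le_trans (ler_normD _ _) _.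
apply: le_trans (lerD (IH i) avg) _.
apply: (@le_trans _ _ ((2 ^+ m - 1) / h%:R * W i + 2 ^+ m / h%:R * W i)).
  by rewrite lerD2r ler_wpM2l // sub // leq_mul2r leqnSn orbT.
by rewrite -mulrDl -mulrDl exprS /W ler_wpM2r ?sumr_ge0 // ler_pM2r ?invr_gt0 //; lra.
Qed.

Lemma window_gap_le_diff (R : realType) (h i : nat) (v : nat -> R) : (0 < h)%N ->
  `|window_gap R h v i| <= \sum_(l < h) `|fdiff R v (i + l)%N|.
Proof.
move=> h0; have h0R : 0 < h%:R :> R by rewrite ltr0n.
have step (j : 'I_h) : `|v i - v (i + j)%N| <= \sum_(l < h) `|fdiff R v (i + l)%N|.
  have -> : v i - v (i + j)%N = - \sum_(0 <= l < j) fdiff R v (i + l)%N.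
    rewrite -[v i](@congr1 _ _ v _ _ (addn0 i)).
    rewrite (eq_bigr (fun l => v (i + l.+1)%N - v (i + l)%N)); last by move=> l _; rewrite /fdiff addnS.
    by rewrite (telescope_sumr (fun l => v (i + l)%N)) // opprB.
  rewrite normrN; apply: le_trans (ler_norm_sum _ _ _) _.
  rewrite -(big_mkord xpredT (fun l => `|fdiff R v (i + l)%N|)).
  by rewrite [leRHS](big_cat_nat (n := j)) //= ?lerDl ?sumr_ge0 // ltnW.
have -> : window_gap R h v i = (\sum_(j < h) (v i - v (i + j)%N)) / h%:R.
  by rewrite sumrB sumr_const card_ord -[_ *+ h]mulr_natl mulrBl mulrAC divff ?mul1r // gt_eqF.
rewrite normrM [`|h%:R^-1|]ger0_norm ?invr_ge0 ?ler0n // ler_pdivrMr //.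
apply: le_trans (ler_norm_sum _ _ _) _.
apply: (@le_trans _ _ (\sum_(j < h) \sum_(l < h) `|fdiff R v (i + l)%N|)).
  by apply: ler_sum => j _; exact: step.
by rewrite sumr_const card_ord mulr_natr.
Qed.

Lemma fdiff_window_gap (R : realType) (h m : nat) (v : nat -> R) (i : nat) :
  fdiff R (iter m (window_gap R h) v) i = iter m (window_gap R h) (fdiff R v) i.
Proof.
elim: m i => [//|m IH] i; rewrite !iterS {1}/fdiff /window_gap.
under [in RHS]eq_bigr do rewrite -IH.
rewrite -IH /fdiff sumrB mulrBl; under eq_bigr do rewrite addSn.
by ring.
Qed.

(** Each factor 1 - T is traded for a difference summed over [h] places, since differences commute
    with T. The nested sums merge into one, and each of the m merges costs a factor [h]. *)
Lemma iter_window_gap_le (R : realType) (h m i : nat) (v : nat -> R) : (0 < h)%N ->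
  `|iter m.+1 (window_gap R h) v i|
    <= h%:R ^+ m * \sum_(l < m.+1 * h) `|iter m.+1 (fdiff R) v (i + l)%N|.
Proof.
move=> h0; elim: m i v => [|m IH] i v.
  by rewrite expr0 mul1r mul1n; exact: window_gap_le_diff.
rewrite iterS; apply: le_trans (window_gap_le_diff _ _ _ _ h0) _.
under eq_bigr do rewrite fdiff_window_gap.
apply: (@le_trans _ _ (\sum_(l < h) (h%:R ^+ m *
    \sum_(j < m.+1 * h) `|iter m.+1 (fdiff R) (fdiff R v) (i + l + j)%N|))).
  by apply: ler_sum => l _; exact: IH.
rewrite -mulr_sumr exprSr -mulrA ler_wpM2l ?exprn_ge0 ?ler0n // -iterSr.
rewrite [(m.+2 * h)%N]mulSnr.
exact: (double_window_sum R h (m.+1 * h) i (fun l => `|iter m.+2 (fdiff R) v l|)).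
Qed.

Lemma sqr_sum_le (R : realType) (n : nat) (w : nat -> R) :
  (\sum_(l < n) w l) ^+ 2 <= n%:R * \sum_(l < n) w l ^+ 2.
Proof.
elim: n => [|n IH]; first by rewrite !big_ord0 mulr0 expr0n.
rewrite !big_ord_recr /=; set S := \sum_(l < n) w l in IH *; set Q := \sum_(l < n) w l ^+ 2 in IH *.
have [n0|n0] := posnP n.
  rewrite /S /Q n0 !big_ord0; lra.
have nR : 0 < n%:R :> R by rewrite ltr0n.
rewrite -(ler_pM2l nR) mulrSr.
have nIH := ler_wpM2l (ltW nR) IH.
have -> : n%:R * (S + w n) ^+ 2 = n%:R * S ^+ 2 + S ^+ 2 + n%:R ^+ 2 * w n ^+ 2
    + n%:R * w n ^+ 2 - (S - n%:R * w n) ^+ 2 by ring.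
have := sqr_ge0 (S - n%:R * w n); lra.
Qed.

(** * Exponential decay of Krawtchouk polynomials *)

(** Induction with [kraw_pairs]: pairs split by S drop out, which leaves the fraction 1 -
    2ab/(N(N-1)) of the pairs, N = a + b. About half of this gain pays for the smaller a or b in the
    exponent; the rest yields exp(-ab/(2N^2)). *)
Lemma kraw_exp_decay (R : realType) (k a b : nat) : (k.*2 <= a + b)%N ->
  `|kraw R k a b| <= expR (- (k%:R * (a%:R * b%:R)) / (2 * (a + b)%:R ^+ 2)).
Proof.
elim: k a b => [|k IH] a b kab.
  by rewrite mul0r oppr0 mul0r expR0 normr1.
have N0 : 0 < (a + b)%:R :> R by rewrite ltr0n; lia.
have N1 : 0 < (a + b).-1%:R :> R by rewrite ltr0n; lia.
have NN : 0 < (a + b)%:R * (a + b).-1%:R :> R by rewrite mulr_gt0.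
have NR : (a + b)%:R = a%:R + b%:R :> R by rewrite natrD.
have N1R : (a + b).-1%:R = a%:R + b%:R - 1 :> R.
  rewrite -natrD -[in RHS](@prednK (a + b)) ?mulrSr ?addrK //; lia.
have kR : (k.+1)%:R * 2 <= a%:R + b%:R :> R.
  by rewrite -natrD -natrM ler_nat; lia.
have k0 : 0 <= k%:R :> R by rewrite ler0n.
have a0 : 0 <= a%:R :> R by rewrite ler0n.
have b0 : 0 <= b%:R :> R by rewrite ler0n.
move: kR; rewrite mulrSr => kR.
set N : R := a%:R + b%:R in kR.
have N2 : 0 < N ^+ 2 by rewrite exprn_gt0 // /N -natrD.
pose E := expR (- (k%:R * (a%:R * b%:R)) / (2 * N ^+ 2)).
(* Passing from (a, b) to (a - 2, b) raises the exponent by at most b / (2N). *)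
have step (c d : nat) (y : R) : (c + d = (a + b).-2)%N -> 0 <= y -> y <= N ->
    c%:R * d%:R = a%:R * b%:R - 2 * y ->
    `|kraw R k c d| <= E * (1 + y / N).
  move=> cd y0 yN cdy; apply: le_trans (IH c d _) _; first by lia.
  have [k00|k1] := posnP k.
    rewrite /E k00 !mul0r !oppr0 !mul0r !expR0 mul1r lerDl divr_ge0 // ltW //.
    by rewrite /N -natrD.
  have M0 : 0 < (c + d)%:R :> R by rewrite ltr0n; lia.
  have MN : (c + d)%:R <= N by rewrite /N -natrD ler_nat; lia.
  have M2 : (c + d)%:R ^+ 2 <= N ^+ 2.
    by apply: lerXn2r; rewrite ?nnegrE ?(ltW M0) //; exact: le_trans (ltW M0) MN.
  have NP : 0 < N by rewrite /N -natrD.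
  apply: (@le_trans _ _ (expR (- (k%:R * (a%:R * b%:R)) / (2 * N ^+ 2) + k%:R * y / N ^+ 2))).
    rewrite ler_expR.
    have -> : - (k%:R * (a%:R * b%:R)) / (2 * N ^+ 2) + k%:R * y / N ^+ 2
       = - ((k%:R * (c%:R * d%:R)) / (2 * N ^+ 2)).
      by rewrite cdy; field; rewrite gt_eqF.
    rewrite mulNr lerN2 ler_wpM2l ?mulr_ge0 // lef_pV2 ?posrE ?mulr_gt0 ?exprn_gt0 //.
    by rewrite ler_pM2l.
  rewrite expRD ler_wpM2l ?expR_ge0 //.
  have z1 : k%:R * y / N ^+ 2 <= y / (2 * N).
    rewrite ler_pdivrMr // expr2 mulrA.
    have -> : y / (2 * N) * N * N = y * (N / 2) by field; rewrite gt_eqF.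
    by rewrite mulrC ler_wpM2l //; lra.
  apply: (@le_trans _ _ (expR (y / (2 * N)))); first by rewrite ler_expR.
  have z2 : 0 <= y / N <= 1 by rewrite divr_ge0 ?(ltW NP) //= ler_pdivrMr ?mul1r.
  have -> : y / (2 * N) = (y / N) / 2 by field; rewrite gt_eqF.
  have /andP[z0 z3] := z2; set z := y / N in z0 z3 *.
  (* exp(z/2) <= 1/(1 - z/2), and (1 + z)(1 - z/2) >= 1 on [0, 1]. *)
  have e1 := expR_ge1Dx (- (z / 2)).
  rewrite expRN in e1; have ep := expR_gt0 (z / 2).
  rewrite -(ler_pM2r ep) mulVf ?gt_eqF // in e1.
  by nra.
have Eb : `|b%:R * b.-1%:R * kraw R k a b.-2|
    <= b%:R * (b%:R - 1) * E * (1 + a%:R / N).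
  case: b @N @E step {IH N1 NN NR N0} kab N1R kR b0 N2 => [|[|b]] N E step kab *.
  - by rewrite !mul0r normr0.
  - by rewrite mulr0 mul0r normr0 subrr mulr0 !mul0r.
  rewrite normrM ger0_norm ?mulr_ge0 // -mulrA.
  have -> : b.+2%:R - 1 = b.+1%:R :> R by rewrite mulrSr addrK.
  rewrite ler_wpM2l ?mulr_ge0 // step //; first by lia.
    by rewrite lerDl.
  by rewrite (mulrSr _ b.+1) (mulrSr _ b); ring.
have Ea : `|a%:R * a.-1%:R * kraw R k a.-2 b|
    <= a%:R * (a%:R - 1) * E * (1 + b%:R / N).
  case: a @N @E step {IH N1 NN NR N0 Eb} kab N1R kR a0 N2 => [|[|a]] N E step kab *.
  - by rewrite !mul0r normr0.
  - by rewrite mulr0 mul0r normr0 subrr mulr0 !mul0r.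
  rewrite normrM ger0_norm ?mulr_ge0 // -mulrA.
  have -> : a.+2%:R - 1 = a.+1%:R :> R by rewrite mulrSr addrK.
  rewrite ler_wpM2l ?mulr_ge0 // step //.
    by rewrite lerDr.
  by rewrite (mulrSr _ a.+1) (mulrSr _ a); ring.
rewrite -(ler_pM2l NN) -[X in X * `|_|]ger0_norm ?(ltW NN) // -normrM kraw_pairs; last by lia.
apply: le_trans (ler_normB _ _) _; apply: le_trans (lerD Eb Ea) _.
rewrite NR N1R -/N.
have -> : - ((k%:R + 1) * (a%:R * b%:R)) / (2 * N ^+ 2)
   = - (k%:R * (a%:R * b%:R)) / (2 * N ^+ 2) + - (a%:R * b%:R / (2 * N ^+ 2)).
  by field; rewrite gt_eqF // /N -natrD.
rewrite expRD -/E.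
have -> : b%:R * (b%:R - 1) * E * (1 + a%:R / N) + a%:R * (a%:R - 1) * E * (1 + b%:R / N)
  = E * (b%:R * (b%:R - 1) * (1 + a%:R / N) + a%:R * (a%:R - 1) * (1 + b%:R / N)) by ring.
rewrite mulrCA ler_wpM2l ?expR_ge0 //.
have NP : 0 < N by rewrite /N -natrD.
have e2 := expR_ge1Dx (- (a%:R * b%:R / (2 * N ^+ 2)) : R).
have NN' : 0 <= N * (N - 1) by rewrite /N -N1R -natrD ltW.
apply: le_trans (ler_wpM2l NN' e2).
have -> : b%:R * (b%:R - 1) * (1 + a%:R / N) + a%:R * (a%:R - 1) * (1 + b%:R / N)
   = N * (N - 1) - a%:R * b%:R - 2 * (a%:R * b%:R) / N.
  by rewrite /N; field; rewrite -natrD gt_eqF.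
have -> : N * (N - 1) * (1 - a%:R * b%:R / (2 * N ^+ 2))
   = N * (N - 1) - a%:R * b%:R / 2 + a%:R * b%:R / N / 2.
  by rewrite /N; field; rewrite -natrD gt_eqF.
have ab0 : 0 <= a%:R * b%:R :> R by rewrite mulr_ge0.
have : 0 <= a%:R * b%:R / N by rewrite divr_ge0 // ltW.
lra.
Qed.

(* a b / (a + b)^2, shifted so that it stays positive when a or b vanishes. *)
Definition spread (R : realType) (a b : nat) : R :=
  a.+1%:R * b.+1%:R / (a + b).+1%:R ^+ 2.

Lemma spread_gt0 (R : realType) (a b : nat) : 0 < spread R a b.
Proof. by rewrite /spread divr_gt0 ?exprn_gt0 ?mulr_gt0 // ltr0n. Qed.

(** For a, b >= 1, (a+1)(b+1) <= 4ab costs a factor 4 in the exponent. The factor 2 serves a = 0 or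
    b = 0, where there is no decay but k times the spread is at most 1. *)
Lemma kraw_spread_decay (R : realType) (k a b : nat) : (k.*2 <= a + b)%N ->
  `|kraw R k a b| <= 2 * expR (- (k%:R * spread R a b / 8)).
Proof.
move=> kab; apply: le_trans (kraw_exp_decay R k a b kab) _.
have k0 : 0 <= k%:R :> R by rewrite ler0n.
have kR : k%:R * 2 <= a%:R + b%:R :> R by rewrite -natrD -natrM ler_nat; lia.
have NP : 0 < a%:R + b%:R + 1 :> R by rewrite -natrD -mulrSr ltr0n.
have S0 := spread_gt0 R a b; rewrite /spread in S0 *.
rewrite natrD !(mulrSr _ a, mulrSr _ b, mulrSr _ (a + b)) natrD in S0 *.
have [ab0|] := boolP ((a == 0%N) || (b == 0%N)).
  have -> : a%:R * b%:R = 0 :> R by case/orP: ab0 => /eqP->; rewrite ?mul0r ?mulr0.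
  rewrite mulr0 oppr0 mul0r expR0.
  set z := _ / 8.
  have z1 : z <= 1 / 2.
    rewrite /z.
    have -> : (a%:R + 1) * (b%:R + 1) / (a%:R + b%:R + 1) ^+ 2 = (a%:R + b%:R + 1)^-1 :> R.
      have -> : (a%:R + 1) * (b%:R + 1) = a%:R + b%:R + 1 :> R.
        by case/orP: ab0 => /eqP->; rewrite ?add0r ?mul1r ?mulr1 ?addr0.
      by field; rewrite gt_eqF.
    have : k%:R / (a%:R + b%:R + 1) <= 1 :> R by rewrite ler_pdivrMr // mul1r; lra.
    lra.
  have := expR_ge1Dx (- z); lra.
rewrite negb_or => /andP[a0 b0].
have a1 : 1 <= a%:R :> R by rewrite ler1n lt0n.
have b1 : 1 <= b%:R :> R by rewrite ler1n lt0n.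
apply: (@le_trans _ _ (expR
  (- (k%:R * ((a%:R + 1) * (b%:R + 1) / (a%:R + b%:R + 1) ^+ 2) / 8)))); last first.
  by rewrite ler_peMl ?expR_ge0 // ler1n.
have M0 : 0 < a%:R + b%:R :> R by lra.
pose X : R := a%:R * b%:R * 4.
have XP : (a%:R + 1) * (b%:R + 1) <= X by rewrite /X; nra.
have X0 : 0 <= X by rewrite /X !mulr_ge0 ?ler0n.
rewrite ler_expR mulNr lerN2.
have -> : k%:R * (a%:R * b%:R) / (2 * (a%:R + b%:R) ^+ 2)
    = k%:R * (X / (8 * (a%:R + b%:R) ^+ 2)) by rewrite /X; field; rewrite gt_eqF.
have -> : k%:R * ((a%:R + 1) * (b%:R + 1) / (a%:R + b%:R + 1) ^+ 2) / 8
    = k%:R * ((a%:R + 1) * (b%:R + 1) / (8 * (a%:R + b%:R + 1) ^+ 2)) :> R.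
  by field; rewrite gt_eqF.
rewrite ler_wpM2l //; apply: (@le_trans _ _ (X / (8 * (a%:R + b%:R + 1) ^+ 2))).
  by apply: ler_wpM2r; rewrite // invr_ge0 mulr_ge0 // sqr_ge0.
rewrite ler_wpM2l // lef_pV2 ?posrE ?mulr_gt0 ?exprn_gt0 // ler_pM2l //.
by apply: lerXn2r; rewrite ?nnegrE ?(ltW NP) ?(ltW M0) // lerDl.
Qed.

(* Exponential decay beats the polynomial weight, leaving a telescoping sum. *)
Lemma sum_exp_weight_le (R : realType) (m : nat) : exists2 C : R, 0 <= C &
  forall (r : R) (n : nat), 0 < r ->
  \sum_(1 <= k < n) k%:R ^+ m.*2.+1 * (r ^+ m.+1 * expR (- (k%:R * r / 8))) ^+ 2 <= C.
Proof.
(* With y = k r, the exponent [j] absorbs y^(2m+1) and two more factors 1 + y for the telescoping.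
   [J = 4 j] makes exp(-y/8)^2 the j-th power of exp(-y/J) <= J/(1 + y). *)
pose j := (m.*2.+3)%N; pose J : R := 4 * j%:R.
have J1 : 1 <= J by rewrite /J -[4]/(4%:R) -natrM ler1n muln_gt0.
have J0 : 0 < J by apply: lt_le_trans J1.
exists (J ^+ j); first by rewrite exprn_ge0 // ltW.
move=> r n r0.
pose T (k : nat) : R := (1 + k%:R * r)^-1.
have P0 k : 0 < 1 + k%:R * r by rewrite ltr_pwDl // mulr_ge0 ?ler0n // ltW.
have T0 k : 0 < T k by rewrite invr_gt0 P0.
have term k : (1 <= k)%N -> k%:R ^+ m.*2.+1 * (r ^+ m.+1 * expR (- (k%:R * r / 8))) ^+ 2
    <= J ^+ j * (T k.-1 - T k).
  case: k => [//|k] _; rewrite succnK.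
  set y := k.+1%:R * r.
  have y0 : 0 < y by rewrite mulr_gt0 ?ltr0n.
  have ypos : 0 < 1 + y by apply: ltr_pwDl => //; exact: ltW.
  have e1 : expR (- (y / 8)) ^+ 2 * (1 + y) ^+ j <= J ^+ j.
    have -> : expR (- (y / 8)) ^+ 2 = expR (- (y / J)) ^+ j.
      rewrite -!expRM_natl; congr expR; rewrite /J; field.
      by rewrite pnatr_eq0.
    rewrite -exprMn; apply: lerXn2r; rewrite ?nnegrE ?mulr_ge0 ?expR_ge0 ?(ltW ypos) ?(ltW J0) //.
    have e2 := expR_ge1Dx (y / J); rewrite expRN ler_pdivrMl ?expR_gt0 //.
    apply: (@le_trans _ _ (J * (1 + y / J))); last by rewrite mulrC ler_wpM2r // ltW.
    by rewrite mulrDr mulr1 mulrCA divff ?gt_eqF // mulr1 lerD2r.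
  have TT : T k - T k.+1 = r * T k * T k.+1.
    rewrite /T mulrSr; field.
    by rewrite !gt_eqF // -?mulrSr ltr_pwDl // ?mulr_ge0 ?ler0n // ltW.
  have Tk : T k.+1 <= T k.
    rewrite /T lef_pV2 ?posrE ?P0 //.
    by rewrite lerD2l ler_pM2r // ler_nat.
  apply: (@le_trans _ _ (J ^+ j * (r * T k.+1 ^+ 2))); last first.
    rewrite ler_wpM2l ?exprn_ge0 ?(ltW J0) // TT expr2 -mulrA ler_wpM2l ?(ltW r0) //.
    by rewrite ler_wpM2r // ltW.
  have -> : k.+1%:R ^+ m.*2.+1 * (r ^+ m.+1 * expR (- (y / 8))) ^+ 2
      = r * y ^+ m.*2.+1 * expR (- (y / 8)) ^+ 2.
    rewrite /y exprMn [in RHS]exprMn -exprM muln2 doubleS (exprS r m.*2.+1); ring.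
  have -> : J ^+ j * (r * T k.+1 ^+ 2) = r * (J ^+ j * T k.+1 ^+ 2) by ring.
  rewrite -mulrA ler_wpM2l ?(ltW r0) //.
  have y1 : y ^+ m.*2.+1 <= (1 + y) ^+ m.*2.+1.
    by apply: lerXn2r; rewrite ?nnegrE ?(ltW ypos) ?(ltW y0) // lerDr.
  apply: (@le_trans _ _ ((1 + y) ^+ m.*2.+1 * expR (- (y / 8)) ^+ 2)).
    by rewrite ler_wpM2r // sqr_ge0.
  rewrite /T -/y exprVn ler_pdivlMr ?exprn_gt0 //.
  by rewrite mulrAC -exprD addn2 mulrC.
have [n1|n1] := leqP n 1.
  by rewrite big_geq // exprn_ge0 // ltW.
apply: (@le_trans _ _ (\sum_(1 <= k < n) J ^+ j * (T k.-1 - T k))).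
  by rewrite big_nat_cond [leRHS]big_nat_cond; apply: ler_sum => k /andP[/andP[k1 _] _]; exact: term.
rewrite -mulr_sumr -[leRHS]mulr1 ler_wpM2l ?exprn_ge0 ?(ltW J0) //.
have -> : \sum_(1 <= k < n) (T k.-1 - T k) = T 0%N - T n.-1.
  case: n n1 => [//|n] n1; rewrite big_add1 /=.
  rewrite (eq_bigr (fun k => - T k.+1 - - T k)); last by move=> k _; rewrite opprK addrC.
  by rewrite (telescope_sumr (fun k => - T k)) // opprK addrC.
by rewrite /T mul0r addr0 invr1 lerBlDr lerDl; exact: ltW (T0 n.-1).
Qed.

(** * Differences in steps of 2 and their weighted square sums *)

(* Steps of 2 are needed because kraw R k a b oscillates with the parity of k when
   a is close to a + b. *)
Definition diff2 (R : realType) (u : nat -> R) (k : nat) : R := u k.+2 - u k.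

Lemma iter_diff2_local (R : realType) (m k : nat) (u v : nat -> R) :
  (forall j, (k <= j <= k + m.*2)%N -> u j = v j) ->
  iter m (diff2 R) u k = iter m (diff2 R) v k.
Proof.
elim: m k => [|m IH] k uv; first by apply: uv; lia.
by rewrite !iterS /diff2 !IH // => j jk; apply: uv; lia.
Qed.

Lemma iter_diff2Z (R : realType) (m k : nat) (c : R) (u : nat -> R) :
  iter m (diff2 R) (fun j => c * u j) k = c * iter m (diff2 R) u k.
Proof.
by elim: m k => [//|m IH] k; rewrite !iterS /diff2 !IH mulrBr.
Qed.

Lemma iter_diff2_sum (R : realType) (I : finType) (m k : nat) (u : I -> nat -> R) :
  iter m (diff2 R) (fun j => \sum_i u i j) k = \sum_i iter m (diff2 R) (u i) k.
Proof.
by elim: m k => [//|m IH] k; rewrite iterS /diff2 !IH -sumrB.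
Qed.

(** Each difference brings a factor ab and lowers a and b by one, so the factor vanishes within m
    steps. *)
Lemma iter_diff2_kraw_eq0 (R : realType) (m k a b : nat) :
  (k + m.*2 <= a + b)%N -> (a < m)%N || (b < m)%N ->
  iter m (diff2 R) (fun j => kraw R j a b) k = 0.
Proof.
elim: m k a b => [|m IH] k a b kab abm; first by rewrite !ltn0 in abm.
rewrite iterSr (@iter_diff2_local _ _ _ _ (fun j =>
  - 4 * (a%:R * b%:R / ((a + b)%:R * (a + b).-1%:R)) * kraw R j a.-1 b.-1)); last first.
  by move=> j jk; rewrite /diff2 kraw_diff2 //; lia.
rewrite iter_diff2Z.
case: a b kab abm => [|a] [|b] kab abm; rewrite ?mul0r ?mulr0 ?mul0r ?mulr0 ?mul0r //.
by rewrite IH ?mulr0 //; lia.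
Qed.

(** [M] is kept apart from [m] so that each step of the induction costs the same factor, by a + m <=
    (M + 1)(a + 1) for m <= M. The spread is taken at the final pair, where the decay bound will be
    applied. *)
Lemma iter_diff2_kraw (R : realType) (M m k a b : nat) :
  (m <= M)%N -> (k <= a + b)%N -> exists2 c : R,
    iter m (diff2 R) (fun j => kraw R j (a + m) (b + m)) k = c * kraw R k a b &
    `|c| <= (4 * M.+1%:R ^+ 2 * spread R a b) ^+ m.
Proof.
elim: m k => [|m IH] k mM kab.
  by exists 1; rewrite ?expr0 ?normr1 //= !addn0 mul1r.
have [c cE cle] := IH k (ltnW mM) kab.
pose N := (a + m.+1 + (b + m.+1))%N.
pose d : R := - 4 * ((a + m.+1)%:R * (b + m.+1)%:R / (N%:R * N.-1%:R)).
exists (d * c).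
  rewrite iterSr (@iter_diff2_local _ _ _ _ (fun j => d * kraw R j (a + m) (b + m))).
    by rewrite iter_diff2Z cE mulrA.
  move=> j jk; rewrite /diff2 kraw_diff2; last by lia.
  by rewrite !addnS !succnK /d /N !addnS.
rewrite normrM exprS; apply: ler_pM; rewrite ?normr_ge0 // {c cE cle IH}.
have -> : 4 * M.+1%:R ^+ 2 * spread R a b = 4 * (M.+1%:R ^+ 2 * spread R a b) by ring.
rewrite /d normrM normrN [`|4|]ger0_norm // ler_wpM2l //.
rewrite ger0_norm ?divr_ge0 ?mulr_ge0 ?ler0n // /spread mulrA.
have P0 : 0 < (a + b).+1%:R :> R by rewrite ltr0n.
apply: (@le_trans _ _ ((a + m.+1)%:R * (b + m.+1)%:R / (a + b).+1%:R ^+ 2)).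
  rewrite ler_wpM2l ?mulr_ge0 ?ler0n // lef_pV2 ?posrE ?exprn_gt0 ?mulr_gt0 ?ltr0n ?/N //; try lia.
  by rewrite expr2; apply: ler_pM; rewrite ?ler0n // ler_nat /N; lia.
apply: ler_wpM2r; first by rewrite invr_ge0 exprn_ge0 // ltW.
have -> : M.+1%:R ^+ 2 * (a.+1%:R * b.+1%:R) = (M.+1%:R * a.+1%:R) * (M.+1%:R * b.+1%:R) :> R by ring.
by apply: ler_pM; rewrite ?ler0n // -natrM ler_nat; nia.
Qed.

(** The differences give r^(m+1), r the spread of the lowered pair, against the decay exp(-kr/8);
    [sum_exp_weight_le] is uniform in r. The range of k ensures 2k <= a + b - 2(m+1), as the decay
    bound demands. *)
Lemma kraw_diff2_energy (R : realType) (m : nat) : exists2 C : R, 0 <= C &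
  forall a b : nat,
  \sum_(1 <= k < (a + b)./2.+1 - m.+1)
     k%:R ^+ m.*2.+1 * iter m.+1 (diff2 R) (fun j => kraw R j a b) k ^+ 2 <= C.
Proof.
have [C C0 HC] := sum_exp_weight_le R m.
pose D : R := 2 * (4 * m.+2%:R ^+ 2) ^+ m.+1.
exists (D ^+ 2 * C); first by rewrite mulr_ge0 ?sqr_ge0.
move=> a b; set n := (_ - _)%N.
have kn k : (k < n)%N -> (k + m.+1 <= (a + b)./2)%N by rewrite /n; lia.
have half k : (k < n)%N -> ((k + m.+1).*2 <= a + b)%N.
  by move=> /kn; have := odd_double_half (a + b); lia.
have [abm|] := boolP ((a < m.+1)%N || (b < m.+1)%N).
  rewrite big_nat_cond big1 ?mulr_ge0 ?sqr_ge0 // => k /andP[/andP[_ /half k2] _].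
  by rewrite iter_diff2_kraw_eq0 ?expr0n ?mulr0 //; lia.
rewrite negb_or -!leqNgt => /andP[am bm].
have S0 := spread_gt0 R (a - m.+1) (b - m.+1).
apply: le_trans (ler_wpM2l (sqr_ge0 D) (HC _ n S0)).
rewrite mulr_sumr big_nat_cond [leRHS]big_nat_cond.
apply: ler_sum => k /andP[/andP[k1 /half k2] _].
rewrite [leRHS]mulrCA ler_wpM2l ?exprn_ge0 ?ler0n // -exprMn.
have [c] := iter_diff2_kraw R m.+1 m.+1 k (a - m.+1) (b - m.+1) (leqnn _) ltac:(lia).
rewrite !subnK // => -> cle.
have kle : `|kraw R k (a - m.+1) (b - m.+1)|
    <= 2 * expR (- (k%:R * spread R (a - m.+1) (b - m.+1) / 8)).
  by apply: kraw_spread_decay; lia.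
rewrite -[leLHS]real_normK ?num_real //; apply: lerXn2r; rewrite ?nnegrE ?normr_ge0 //.
  by rewrite !mulr_ge0 ?exprn_ge0 ?expR_ge0 ?mulr_ge0 ?exprn_ge0 ?ler0n ?(ltW S0).
rewrite normrM; apply: le_trans (ler_pM _ _ cle kle) _; rewrite ?normr_ge0 //.
by rewrite /D exprMn le_eqVlt; apply/orP; left; apply/eqP; ring.
Qed.

(** * Weights and translations on the hypercube *)

Definition basis_vec (N : nat) (i : 'I_N) : hypercube N := delta_mx ord0 i.

Lemma F2_neq1 (u : 'F_2) : (u != 1) = (u == 0).
Proof. by case: u => -[|[|//]] ?. Qed.

Lemma F2_add1_eq1 (u : 'F_2) : (u + 1 == 1) = (u != 1).
Proof. by case: u => -[|[|//]] ?. Qed.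

Lemma F2_addxx (u : 'F_2) : u + u = 0.
Proof. by case: u => -[|[|//]] ?; apply/val_inj. Qed.

Lemma hypercube_addxx (N : nat) (y : hypercube N) : y + y = 0.
Proof. by apply/matrixP => i j; rewrite !mxE F2_addxx. Qed.

Lemma hypercube_opp (N : nat) (y : hypercube N) : - y = y.
Proof. by apply/eqP; rewrite eq_sym -addr_eq0 hypercube_addxx. Qed.

Lemma addr_involutive (N : nat) (y : hypercube N) : involutive (fun x => x + y).
Proof. by move=> x; rewrite -addrA hypercube_addxx addr0. Qed.

Lemma add_basis_eq1 (N : nat) (y : hypercube N) (i j : 'I_N) :
  ((y + basis_vec N i) ord0 j == 1) = if j == i then y ord0 j != 1 else y ord0 j == 1.
Proof.
rewrite !mxE eqxx andTb; case: (j == i); rewrite ?addr0 //.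
exact: F2_add1_eq1.
Qed.

Lemma hweight_add_basis (N : nat) (y : hypercube N) (i : 'I_N) :
  hweight (y + basis_vec N i) = if y ord0 i == 1 then (hweight y).-1 else (hweight y).+1.
Proof.
rewrite /hweight; case: ifPn => yi.
  rewrite [in RHS](cardsD1 i) inE yi add1n succnK; congr #|pred_of_set _|.
  by apply/setP => j; rewrite !inE add_basis_eq1; case: eqP => [->|]; rewrite ?yi.
rewrite (cardsD1 i) inE add_basis_eq1 eqxx yi add1n; congr (#|pred_of_set _|.+1).
apply/setP => j; rewrite !inE add_basis_eq1; case: eqP => [->|] //=.
by rewrite (negPf yi).
Qed.

Lemma hweight_le (N : nat) (y : hypercube N) : (hweight y <= N)%N.
Proof. by rewrite -[leqRHS]card_ord max_card. Qed.

Lemma hweight_natr (R : realType) (N : nat) (y : hypercube N) :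
  \sum_i (y ord0 i == 1)%:R = (hweight y)%:R :> R.
Proof.
rewrite -natr_sum /hweight -sum1_card [in RHS]big_mkcond /=; congr (_%:R).
by apply: eq_bigr => i _; rewrite inE; case: eqP.
Qed.

Lemma hweight_antipode (N : nat) (y : hypercube N) :
  hweight (y + const_mx 1) = (N - hweight y)%N.
Proof.
rewrite -[X in (X - _)%N]card_ord -(cardsC [set i | y ord0 i == 1]) /hweight addKn.
by congr #|pred_of_set _|; apply/setP => i; rewrite !inE !mxE F2_add1_eq1.
Qed.

Lemma card_hweight (N k : nat) : #|[set y : hypercube N | hweight y == k]| = 'C(N, k).
Proof.
pose supp (y : hypercube N) := [set i : 'I_N | y ord0 i == 1].
pose vec (A : {set 'I_N}) : hypercube N := \row_i (i \in A)%:R.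
have suppK : cancel supp vec.
  move=> y; apply/rowP => i; rewrite !mxE inE.
  case: eqP => [->//|/eqP]; rewrite F2_neq1 => /eqP ->.
  by [].
have vecK : cancel vec supp.
  by move=> A; apply/setP => i; rewrite !inE mxE; case: (i \in A).
rewrite -[in RHS](card_ord N) -card_draws -(on_card_preimset (f := supp)).
  by congr #|pred_of_set _|; apply/setP => y; rewrite !inE.
exact: onW_bij (Bijective suppK vecK).
Qed.

Lemma card_hypercube (N : nat) : #|{: hypercube N}| = (2 ^ N)%N.
Proof. by rewrite card_mx card_Fp // mul1n. Qed.

(** * Spherical averages and their neighbour relation *)

Definition sphere_avg (R : realType) (N : nat) (f : hypercube N -> R) (k : nat)
    (z : hypercube N) : R :=
  (\sum_(y | hweight y == k) f (z + y)) / 'C(N, k)%:R.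

Lemma sphere_avg0 (R : realType) (N : nat) (f : hypercube N -> R) (z : hypercube N) :
  sphere_avg R N f 0 z = f z.
Proof.
rewrite /sphere_avg bin0 divr1 (bigD1 0) /=; last first.
  by rewrite /hweight cards_eq0; apply/eqP/setP => i; rewrite !inE mxE.
rewrite addr0 big1 ?addr0 // => y /andP[/eqP y0 /eqP[]].
apply/rowP => i; rewrite mxE; apply/eqP; rewrite -F2_neq1.
by move/cards0_eq/setP/(_ i): y0; rewrite !inE => ->.
Qed.

Lemma sphere_avg_ge0 (R : realType) (N : nat) (f : hypercube N -> R) k z :
  (forall x, 0 <= f x) -> 0 <= sphere_avg R N f k z.
Proof. by move=> f0; rewrite divr_ge0 ?ler0n // sumr_ge0. Qed.

Lemma sum_sphere_avg (R : realType) (N : nat) (f : hypercube N -> R) k : (k <= N)%N ->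
  \sum_z sphere_avg R N f k z = \sum_x f x.
Proof.
move=> kN; rewrite -mulr_suml exchange_big /=.
have C0 : 'C(N, k)%:R != 0 :> R by rewrite pnatr_eq0 -lt0n bin_gt0.
apply/eqP; rewrite -(inj_eq (mulIf C0)) divfK //; apply/eqP.
rewrite (eq_bigr (fun=> \sum_x f x)); last first.
  by move=> y _; rewrite [RHS](reindex_inj (inv_inj (addr_involutive N y))).
rewrite sumr_const -[_ *+ _]mulr_natr -card_hweight; congr (_ * _%:R).
by apply: eq_card => y; rewrite !inE.
Qed.

(** Group the pairs (y, i) by the endpoint y + e_i: one of weight k + 1 arises from k + 1 indices,
    one of weight k - 1 from N - k + 1. The condition [(hweight y).+1 == k] makes the second sum
    empty at k = 0. *)
Lemma sphere_sum_nbr (R : realType) (N k : nat) (g : hypercube N -> R) :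
  \sum_i \sum_(y | hweight y == k) g (y + basis_vec N i)
  = k.+1%:R * (\sum_(y | hweight y == k.+1) g y)
    + (N - k.-1)%:R * (\sum_(y | (hweight y).+1 == k) g y).
Proof.
transitivity (\sum_(i < N) \sum_y g y *
   (((y ord0 i == 1) && (hweight y == k.+1))%:R + ((y ord0 i != 1) && ((hweight y).+1 == k))%:R)).
  apply: eq_bigr => i _.
  rewrite (reindex_inj (inv_inj (addr_involutive N (basis_vec N i)))) /= big_mkcond /=.
  apply: eq_bigr => y _; rewrite addr_involutive hweight_add_basis.
  case: (boolP (y ord0 i == 1)) => yi /=; rewrite ?add0r ?addr0.
    have -> : ((hweight y).-1 == k) = (hweight y == k.+1).
      have : (0 < hweight y)%N by rewrite /hweight; apply/card_gt0P; exists i; rewrite inE.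
      by lia.
    by case: eqP; rewrite ?mulr1 ?mulr0.
  by case: eqP; rewrite ?mulr1 ?mulr0.
rewrite exchange_big /= !mulr_sumr [in RHS]big_mkcond [X in _ = _ + X]big_mkcond -big_split /=.
apply: eq_bigr => y _; rewrite -mulr_sumr big_split /=.
have c1 := hweight_natr R N y.
have c0 : \sum_(i < N) (y ord0 i != 1)%:R = (N - hweight y)%:R :> R.
  rewrite natrB ?hweight_le // -c1 -[X in X%:R - _]card_ord -sumr_const -sumrB.
  by apply: eq_bigr => i _; case: eqP; rewrite ?subrr ?subr0.
rewrite mulrDr; congr (_ + _).
  case: eqP => [yk|_]; last by rewrite big1 ?mulr0 // => i _; rewrite andbF.
  by rewrite mulrC -yk -c1; congr (_ * _); apply: eq_bigr => i _; rewrite andbT.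
case: eqP => [yk|_]; last by rewrite big1 ?mulr0 // => i _; rewrite andbF.
by rewrite mulrC -yk succnK -c0; congr (_ * _); apply: eq_bigr => i _; rewrite andbT.
Qed.

Lemma sphere_avg_nbr (R : realType) (N k : nat) (f : hypercube N -> R) (z : hypercube N) :
  (k < N)%N ->
  \sum_i sphere_avg R N f k (z + basis_vec N i)
  = k%:R * sphere_avg R N f k.-1 z + (N - k)%:R * sphere_avg R N f k.+1 z.
Proof.
move=> kN; rewrite -mulr_suml.
have C0 j : (j <= N)%N -> 'C(N, j)%:R != 0 :> R by move=> jN; rewrite pnatr_eq0 -lt0n bin_gt0.
have := sphere_sum_nbr R N k (fun y => f (z + y)).
rewrite (eq_bigr (fun i => \sum_(y | hweight y == k) f (z + basis_vec N i + y))); last first.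
  by move=> i _; apply: eq_bigr => y _; rewrite -addrA [y + _]addrC.
move=> ->; rewrite mulrDl /sphere_avg addrC; congr (_ + _); last first.
  have := mul_bin_left N k => /(congr1 (fun n => n%:R : R)); rewrite !natrM => E.
  have {}E : (N - k)%:R / 'C(N, k.+1)%:R = k.+1%:R / 'C(N, k)%:R :> R.
    by apply/eqP; rewrite eqr_div ?C0 // ?(ltnW kN) // -E mulrC.
  by rewrite mulrCA E; ring.
case: k kN {C0} => [|k] kN.
  by rewrite big_pred0 ?mulr0 ?mul0r // => y.
have C1 j : (j <= N)%N -> 'C(N, j)%:R != 0 :> R by move=> jN; rewrite pnatr_eq0 -lt0n bin_gt0.
have := mul_bin_left N k => /(congr1 (fun n => n%:R : R)); rewrite !natrM => E.
have {}E : k.+1%:R / 'C(N, k)%:R = (N - k)%:R / 'C(N, k.+1)%:R :> R.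
  by apply/eqP; rewrite eqr_div ?C1 ?(ltnW kN) // ?E 1?mulrC // ltnW // ltnW.
by rewrite !succnK mulrCA E; ring.
Qed.

(** * Walsh functions and the L^2 bound for the square function *)

Definition walsh (R : realType) (N : nat) (s x : hypercube N) : R :=
  \prod_i (-1) ^+ ((s ord0 i == 1) && (x ord0 i == 1)).

Lemma walshC (R : realType) (N : nat) (s x : hypercube N) : walsh R N s x = walsh R N x s.
Proof. by apply: eq_bigr => i _; rewrite andbC. Qed.

Lemma walshD (R : realType) (N : nat) (s x y : hypercube N) :
  walsh R N s (x + y) = walsh R N s x * walsh R N s y.
Proof.
rewrite -big_split /=; apply: eq_bigr => i _; rewrite !mxE.
case: (s ord0 i == 1) => /=; last by rewrite mulr1.
rewrite -signr_addb; congr (_ ^+ (nat_of_bool _)).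
by move: (x ord0 i) (y ord0 i) => [[|[|//]] p] [[|[|//]] q].
Qed.

Lemma walsh_basis (R : realType) (N : nat) (s : hypercube N) (i : 'I_N) :
  walsh R N s (basis_vec N i) = (-1) ^+ (s ord0 i == 1).
Proof.
rewrite /walsh (bigD1 i) //= big1 ?mulr1; last first.
  by move=> j ji; rewrite mxE eqxx (negPf ji) /= andbF.
by rewrite mxE !eqxx andbT.
Qed.

Lemma sum_walsh_basis (R : realType) (N : nat) (s : hypercube N) :
  \sum_i walsh R N s (basis_vec N i) = (N - hweight s)%:R - (hweight s)%:R.
Proof.
have hN := hweight_le N s.
rewrite natrB // -hweight_natr -[X in X%:R - _]card_ord -sumr_const -!sumrB.
by apply: eq_bigr => i _; rewrite walsh_basis; case: eqP => _ /=; ring.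
Qed.

Lemma sum_walsh (R : realType) (N : nat) (x : hypercube N) :
  \sum_s walsh R N s x = (x == 0)%:R * 2 ^+ N.
Proof.
have [->|x0] := eqVneq x 0.
  rewrite (eq_bigr (fun=> 1)); last first.
    by move=> s _; apply: big1 => i _; rewrite mxE andbF.
  by rewrite sumr_const card_hypercube mul1r natrX.
have [i xi] : exists i, x ord0 i == 1.
  apply/existsP; apply: contraNT x0; rewrite negb_exists => /forallP xi.
  by apply/eqP/rowP => i; rewrite mxE; apply/eqP; rewrite -F2_neq1.
rewrite mul0r; set S := \sum_s _.
have : S = - S.
  rewrite {1}/S (reindex_inj (inv_inj (addr_involutive N (basis_vec N i)))) -sumrN.
  apply: eq_bigr => s _.
  by rewrite walshC walshD walsh_basis xi expr1 mulrN1 walshC.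
lra.
Qed.

Lemma parseval (R : realType) (N : nat) (u : hypercube N -> R) :
  \sum_s (\sum_x u x * walsh R N s x) ^+ 2 = 2 ^+ N * \sum_x u x ^+ 2.
Proof.
transitivity (\sum_x \sum_y u x * u y * \sum_s walsh R N s (x + y)).
  under eq_bigr do rewrite expr2 big_distrlr /=.
  rewrite exchange_big; apply: eq_bigr => x _ /=.
  rewrite exchange_big; apply: eq_bigr => y _ /=.
  by rewrite mulr_sumr; apply: eq_bigr => s _; rewrite walshD; ring.
rewrite mulr_sumr; apply: eq_bigr => x _.
rewrite (bigD1 x) //= [X in _ + X]big1 ?addr0.
  by rewrite sum_walsh hypercube_addxx eqxx mul1r; ring.
by move=> y yx; rewrite sum_walsh addr_eq0 hypercube_opp eq_sym (negPf yx) mul0r mulr0.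
Qed.

(** Both sides start from the same value and obey the same three-term recurrence, [sphere_avg_nbr]
    on the left and [kraw_three_term] on the right. *)
Lemma sphere_avg_walsh (R : realType) (N k : nat) (s z : hypercube N) : (k <= N)%N ->
  sphere_avg R N (walsh R N s) k z = kraw R k (hweight s) (N - hweight s) * walsh R N s z.
Proof.
have sN := hweight_le N s.
pose P k := forall z, sphere_avg R N (walsh R N s) k z
   = kraw R k (hweight s) (N - hweight s) * walsh R N s z.
have P0 : P 0%N by move=> y; rewrite sphere_avg0 mul1r.
have step j : (j < N)%N -> P j.-1 -> P j -> P j.+1.
  move=> jN Pj1 Pj y.
  have Nj : (N - j)%:R != 0 :> R by rewrite pnatr_eq0 -lt0n subn_gt0.
  have := sphere_avg_nbr R N j (walsh R N s) y jN.
  rewrite (eq_bigr (fun i => kraw R j (hweight s) (N - hweight s) * walsh R N s y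
     * walsh R N s (basis_vec N i))); last by move=> i _; rewrite Pj walshD mulrA.
  rewrite -mulr_sumr sum_walsh_basis Pj1 => E; apply: (mulfI Nj).
  have jN' : (j < hweight s + (N - hweight s))%N by rewrite subnKC.
  have := kraw_three_term R j _ _ jN'; rewrite subnKC // => T.
  apply/(addrI (j%:R * (kraw R j.-1 (hweight s) (N - hweight s) * walsh R N s y))).
  by rewrite -E [in RHS]mulrA [X in _ = _ + X]mulrA -mulrDl -T; ring.
suff H j : (j.+1 <= N)%N -> P j /\ P j.+1.
  by case: k => [|k] kN; [exact: P0|case: (H k kN)].
elim: j => [|j IH] jN; first by split=> //; apply: step.
by have [Pj Pj1] := IH (ltnW jN); split=> //; apply: step.
Qed.

(** The spherical average is self-adjoint, so it can be moved onto the Walsh function, its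
    eigenfunction. *)
Lemma sphere_avg_fourier (R : realType) (N k : nat) (f : hypercube N -> R)
    (s : hypercube N) : (k <= N)%N ->
  \sum_z sphere_avg R N f k z * walsh R N s z
  = kraw R k (hweight s) (N - hweight s) * \sum_x f x * walsh R N s x.
Proof.
move=> kN; transitivity (\sum_x f x * sphere_avg R N (walsh R N s) k x); last first.
  by rewrite mulr_sumr; apply: eq_bigr => x _; rewrite sphere_avg_walsh //; ring.
under eq_bigr do rewrite /sphere_avg mulrAC mulr_suml.
rewrite -mulr_suml exchange_big /=.
under [RHS]eq_bigr do rewrite /sphere_avg mulrA mulr_sumr.
rewrite -mulr_suml [in RHS]exchange_big /=; congr (_ * _); apply: eq_bigr => y _.
rewrite (reindex_inj (inv_inj (addr_involutive N y))) /=.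
by apply: eq_bigr => x _; rewrite addr_involutive.
Qed.

(** By Parseval each frequency s contributes |F(s)|^2 times the sum bounded in [kraw_diff2_energy],
    uniformly in s and N. *)
Lemma sphere_avg_energy (R : realType) (m : nat) : exists2 C : R, 0 <= C &
  forall (N : nat) (f : hypercube N -> R),
  \sum_z \sum_(1 <= k < N./2.+1 - m.+1)
     k%:R ^+ m.*2.+1 * iter m.+1 (diff2 R) (fun j => sphere_avg R N f j z) k ^+ 2
  <= C * \sum_x f x ^+ 2.
Proof.
have [C C0 HC] := kraw_diff2_energy R m.
exists C => // N f.
have P0 : 0 < 2 ^+ N :> R by rewrite exprn_gt0.
rewrite exchange_big /= -(ler_pM2l P0) mulrCA -parseval mulr_sumr.
pose F (s : hypercube N) := \sum_x f x * walsh R N s x.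
pose K (s : hypercube N) k := iter m.+1 (diff2 R) (fun j => kraw R j (hweight s) (N - hweight s)) k.
have E k : (k < N./2.+1 - m.+1)%N ->
   2 ^+ N * \sum_z iter m.+1 (diff2 R) (fun j => sphere_avg R N f j z) k ^+ 2
   = \sum_s (F s * K s k) ^+ 2.
  move=> kn; rewrite -parseval; apply: eq_bigr => s _; congr (_ ^+ 2).
  under eq_bigr do rewrite mulrC -iter_diff2Z.
  rewrite -iter_diff2_sum /K -iter_diff2Z; apply: iter_diff2_local => j jk.
  have jN : (j <= N)%N by have := odd_double_half N; lia.
  rewrite mulrC -(sphere_avg_fourier R N j f s jN).
  by apply: eq_bigr => z _; rewrite mulrC.
apply: (@le_trans _ _ (\sum_s F s ^+ 2 * \sum_(1 <= k < N./2.+1 - m.+1)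
    k%:R ^+ m.*2.+1 * K s k ^+ 2)).
  under [leRHS]eq_bigr do rewrite mulr_sumr.
  rewrite [leRHS]exchange_big /= big_nat_cond [leRHS]big_nat_cond.
  apply: ler_sum => k /andP[/andP[_ kn] _].
  rewrite -mulr_sumr mulrCA E // mulr_sumr le_eqVlt; apply/orP; left; apply/eqP.
  by apply: eq_bigr => s _; rewrite exprMn mulrCA.
rewrite mulr_sumr; apply: ler_sum => s _; rewrite [leRHS]mulrC ler_wpM2l ?sqr_ge0 //.
by have := HC (hweight s) (N - hweight s)%N; rewrite subnKC // hweight_le.
Qed.

(** * The nearest neighbour walk and the maximal bound for sums over radii *)

Definition nbr_avg (R : realType) (N : nat) (f : hypercube N -> R) (z : hypercube N) : R :=
  (\sum_i f (z + basis_vec N i)) / N%:R.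

(* (n - 2k)+ / M is a subsolution of the evolution of the expected occupation
   times of the walk, which drifts away from its origin at speed at least 1/2. *)
Lemma ergodic_sum_ge (R : realType) (N M n : nat) (f : hypercube N -> R) (z : hypercube N) :
  (forall x, 0 <= f x) -> (0 < M)%N -> (M.*2 <= N)%N -> (n <= M)%N ->
  (\sum_(0 <= k < M) (n - k.*2)%:R * sphere_avg R N f k z) / M%:R
    <= ergodic_sum R (hypercube N) (nbr_avg R N) f n z.
Proof.
move=> f0; case: M => [//|M] _ MN; elim: n z => [|n IH] z nM.
  by rewrite big_nat_cond big1 ?mul0r // => k _; rewrite sub0n mul0r.
have A0 k : 0 <= sphere_avg R N f k z by apply: sphere_avg_ge0.
have NP : 0 < N%:R :> R by rewrite ltr0n; lia.
have MP : 0 < M.+1%:R :> R by rewrite ltr0n.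
rewrite [leRHS]/=.
apply: (@le_trans _ _ (f z + (\sum_i (\sum_(0 <= k < M.+1) (n - k.*2)%:R
     * sphere_avg R N f k (z + basis_vec N i)) / M.+1%:R) / N%:R)); last first.
  rewrite lerD2l ler_pM2r ?invr_gt0 //; apply: ler_sum => i _; exact: IH (ltnW nM).
rewrite -mulr_suml exchange_big /=.
have -> : \sum_(0 <= k < M.+1) \sum_i (n - k.*2)%:R * sphere_avg R N f k (z + basis_vec N i)
  = \sum_(0 <= k < M.+1) (n - k.*2)%:R * k%:R * sphere_avg R N f k.-1 z
    + \sum_(0 <= k < M.+1) (n - k.*2)%:R * (N - k)%:R * sphere_avg R N f k.+1 z.
  rewrite -big_split /= big_nat_cond [RHS]big_nat_cond.
  apply: eq_bigr => k /andP[/andP[_ kN] _].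
  by rewrite -mulr_sumr sphere_avg_nbr ?mulrDr ?mulrA //; lia.
rewrite -[f z](sphere_avg0 R N f z).
pose c k := (n - k.+1.*2)%:R * k.+1%:R * sphere_avg R N f k z.
have up : \sum_(0 <= k < M.+1) (n - k.*2)%:R * k%:R * sphere_avg R N f k.-1 z
   >= \sum_(0 <= k < M) c k.+1.
  rewrite big_nat_recl //= mulr0 mul0r add0r.
  have cM : c M = 0 by rewrite /c (_ : n - M.+1.*2 = 0)%N ?mul0r //; lia.
  rewrite -[leRHS]addr0 -[X in _ <= _ + X]cM -(@big_nat_recr _ _ _ M 0 c) // big_nat_recl //= lerDr.
  by rewrite /c mulr_ge0 ?A0 // -natrM ler0n.
have down : \sum_(0 <= k < M.+1) (n - k.*2)%:R * (N - k)%:R * sphere_avg R N f k.+1 z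
   >= \sum_(0 <= k < M) (n - k.*2)%:R * (N - k)%:R * sphere_avg R N f k.+1 z.
  by rewrite [leRHS]big_nat_recr //= lerDl mulr_ge0 ?A0 // -natrM ler0n.
apply: (@le_trans _ _ (sphere_avg R N f 0 z + (\sum_(0 <= k < M) c k.+1 +
   \sum_(0 <= k < M) (n - k.*2)%:R * (N - k)%:R * sphere_avg R N f k.+1 z) / M.+1%:R / N%:R));
  last by rewrite lerD2l !ler_pM2r ?invr_gt0 // lerD.
rewrite big_nat_recl // double0 subn0 mulrDl; apply: lerD.
  by rewrite mulrAC ler_piMl // ler_pdivrMr // mul1r ler_nat.
rewrite -big_split /= mulrAC ler_pM2r ?invr_gt0 // ler_pdivlMr // mulr_suml.
(* Coefficients of A_(k+1): with n = 2k + d + 2 the claim is (d+1) N <= (d-2)(k+2) + (d+2)(N-k), d -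
   2 truncated at 0. It follows from N >= 2(n+1). *)
apply: ler_sum => k _; rewrite /c -mulrDl mulrAC ler_wpM2r // -!natrM -natrD ler_nat.
have [nk|nk] := leqP n k.*2.+1; first by rewrite (_ : n.+1 - k.+1.*2 = 0)%N ?mul0n //; lia.
have [d E] : exists d, n = (k.*2 + d.+2)%N by exists (n - k.*2.+2)%N; lia.
rewrite E; have -> : ((k.*2 + d.+2).+1 - k.+1.*2 = d.+1)%N by lia.
have -> : ((k.*2 + d.+2) - k.*2 = d.+2)%N by lia.
have [d2|d2] := leqP d 1.
  have -> : (k.*2 + d.+2 - k.+2.*2 = 0)%N by lia.
  by move: d2; case: d E => [|[|//]] E _; nia.
have -> : (k.*2 + d.+2 - k.+2.*2 = d - 2)%N by lia.
nia.
Qed.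

(** Take n = M = 4K in [ergodic_sum_ge]: for k <= K the weight (n - 2k)/M is at least 1/2. The
    condition 2M <= N there is the origin of 8K <= N. *)
Lemma cesaro_le_ergodic_sum (R : realType) (N K : nat) (f : hypercube N -> R) (z : hypercube N) :
  (forall x, 0 <= f x) -> (0 < K)%N -> (8 * K <= N)%N ->
  \sum_(0 <= k < K.+1) sphere_avg R N f k z
    <= 2 * ergodic_sum R (hypercube N) (nbr_avg R N) f (4 * K) z.
Proof.
move=> f0 K0 KN.
have A0 k : 0 <= sphere_avg R N f k z by apply: sphere_avg_ge0.
have := @ergodic_sum_ge R N (4 * K) (4 * K) f z f0 ltac:(lia) ltac:(lia) (leqnn _).
have KP : 0 < (4 * K)%:R :> R by rewrite ltr0n; lia.
rewrite ler_pdivrMr // => H.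
have K2 : 0 < (2 * K)%:R :> R by rewrite ltr0n; lia.
rewrite -(ler_pM2l K2).
have -> : (2 * K)%:R * (2 * ergodic_sum R (hypercube N) (nbr_avg R N) f (4 * K) z)
  = ergodic_sum R (hypercube N) (nbr_avg R N) f (4 * K) z * (4 * K)%:R.
  by rewrite !natrM; ring.
apply: le_trans H; rewrite [leRHS](big_cat_nat (n := K.+1)) //=; last by lia.
rewrite -[leLHS]addr0 lerD ?sumr_ge0 // => [|k _]; last by rewrite mulr_ge0.
rewrite mulr_sumr [leLHS]big_nat_cond [leRHS]big_nat_cond.
by apply: ler_sum => k /andP[/andP[_ kK] _]; rewrite ler_wpM2r // ler_nat; lia.
Qed.

(** A sum above 8Kt forces an ergodic sum of length 4K above 4Kt, and Hopf's inequality applies. *)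
Lemma cesaro_maximal (R : realType) (N : nat) (f : hypercube N -> R) (t : R) :
  (0 < N)%N -> (forall x, 0 <= f x) -> 
  #|[set z | [exists K : 'I_N, [&& (0 < K)%N, (8 * K <= N)%N &
     8 * K%:R * t < \sum_(0 <= k < K.+1) sphere_avg R N f k z]]]|%:R * t
    <= \sum_x f x.
Proof.
move=> N0 f0; have NP : 0 < N%:R :> R by rewrite ltr0n.
have nbrB g c x : nbr_avg R N (fun y => g y - c) x = nbr_avg R N g x - c.
  rewrite /nbr_avg sumrB sumr_const card_ord mulrBl -[c *+ N]mulr_natr mulfK //.
  by rewrite gt_eqF.
have nbrS g : \sum_x nbr_avg R N g x = \sum_x g x.
  rewrite -mulr_suml exchange_big /= (eq_bigr (fun=> \sum_x g x)); last first.
    by move=> i _; rewrite [RHS](reindex_inj (inv_inj (addr_involutive N (basis_vec N i)))).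
  by rewrite sumr_const card_ord -[_ *+ N]mulr_natr mulfK // gt_eqF.
have nbrM g h : (forall x, g x <= h x) -> forall x, nbr_avg R N g x <= nbr_avg R N h x.
  by move=> gh x; rewrite ler_pM2r ?invr_gt0 //; apply: ler_sum.
have nbr0 x : nbr_avg R N (fun=> 0) x = 0 by rewrite /nbr_avg big1 ?mul0r.
have H := @hopf_maximal R _ (nbr_avg R N) f t (4 * N) nbrM nbr0 nbrB nbrS f0.
have [t0|t0] := leP 0 t; last first.
  by apply: le_trans (sumr_ge0 _ (fun x _ => f0 x)); rewrite mulr_ge0_le0 // ltW.
apply: le_trans H; apply: ler_wpM2r => //; rewrite ler_nat; apply: subset_leq_card.
apply/fintype.subsetP => z; rewrite !inE => /existsP[K /and3P[K0 KN tK]].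
have KN4 : (4 * K < (4 * N).+1)%N by have := ltn_ord K; lia.
apply/existsP; exists (Ordinal KN4) => /=.
have := lt_le_trans tK (cesaro_le_ergodic_sum R N K f z f0 K0 KN).
by rewrite natrM; lra.
Qed.

(** * Smoothing along radii of one parity *)

(** The bound on [n] keeps k - 2l from being truncated, so the indices are distinct. *)
Lemma sum_stride2_le (R : realType) (u : nat -> R) (n k : nat) :
  (forall j, 0 <= u j) -> (n.*2 <= k.+2)%N ->
  \sum_(l < n) u (k - l.*2)%N <= \sum_(0 <= j < k.+1) u j.
Proof.
move=> u0; elim: n k => [|n IH] k nk; first by rewrite big_ord0 sumr_ge0.
rewrite big_ord_recl /= subn0 big_nat_recr //= [leLHS]addrC lerD2r.
case: k nk => [|[|k]] nk.
- by have -> : n = 0%N by [lia]; rewrite big_ord0 sumr_ge0.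
- by have -> : n = 0%N by [lia]; rewrite big_ord0 sumr_ge0.
rewrite big_nat_recr //= -[leLHS]addr0 lerD // IH //; lia.
Qed.

Lemma iter_diff_reversed (R : realType) (u : nat -> R) (k m l : nat) :
  ((l + m).*2 <= k)%N ->
  iter m (fdiff R) (fun i => u (k - i.*2)%N) l
  = (-1) ^+ m * iter m (diff2 R) u (k - (l + m).*2)%N.
Proof.
elim: m l => [|m IH] l lk; first by rewrite expr0 mul1r addn0.
rewrite !iterS /fdiff /diff2 !IH; try lia.
have -> : (k - (l + m.+1).*2).+2 = (k - (l + m).*2)%N by lia.
by rewrite addSnnS exprS; ring.
Qed.

(** The splitting of A_k f by (1 - T)^(m+1), for one sequence [u]: the first term is bounded by
    [window_gap_close], and [B] bounds the second by differences. *)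
Lemma smoothing_bound (R : realType) (u : nat -> R) (m k h : nat) (d : R) :
  (forall j, 0 <= u j) -> (0 < h)%N -> h%:R <= d * k%:R -> (8 * m.+1 * h <= k)%N ->
  exists B : R, u k <= 2 ^+ m.+1 / h%:R * (\sum_(0 <= j < k.+1) u j) + B /\
    B ^+ 2 <= m.+1%:R * (2 * d) ^+ m.*2.+1 *
      \sum_(1 <= j < k.+1 - m.+1.*2) j%:R ^+ m.*2.+1 * iter m.+1 (diff2 R) u j ^+ 2.
Proof.
move=> u0 h0 hd hk.
pose v i := u (k - i.*2)%N; pose D j := iter m.+1 (diff2 R) u j.
exists (h%:R ^+ m * \sum_(l < m.+1 * h) `|D (k - (l + m.+1).*2)%N|); split.
  have := window_gap_close R h m.+1 0 v h0; have := iter_window_gap_le R h m 0 v h0.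
  under eq_bigr do rewrite add0n.
  under [X in _ -> _ <= _ * X -> _]eq_bigr do rewrite add0n.
  set W := iter _ (window_gap _ _) _ _ => HW Hv.
  have -> : u k = (v 0%N - W) + W by rewrite /v double0 subn0 subrK.
  apply: le_trans (ler_norm _) _; apply: le_trans (ler_normD _ _) _; apply: lerD.
    apply: le_trans Hv _; rewrite ler_wpM2l ?divr_ge0 ?exprn_ge0 ?ler0n //.
    rewrite (eq_bigr (fun l : 'I__ => u (k - l.*2)%N)); last first.
      by move=> l _; rewrite ger0_norm // /v u0.
    by apply: sum_stride2_le => //; lia.
  apply: le_trans HW _; rewrite ler_wpM2l ?exprn_ge0 ?ler0n //.
  apply: ler_sum => l _; rewrite iter_diff_reversed ?normrM ?normrX ?normrN1 ?expr1n ?mul1r //.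
  by have := ltn_ord l; nia.
rewrite exprMn; apply: le_trans (ler_wpM2l (sqr_ge0 _)
  (sqr_sum_le R (m.+1 * h) (fun l => `|D (k - (l + m.+1).*2)%N|))) _.
have -> : (h%:R ^+ m) ^+ 2 * ((m.+1 * h)%:R * \sum_(l < m.+1 * h) `|D (k - (l + m.+1).*2)%N| ^+ 2)
  = m.+1%:R * \sum_(l < m.+1 * h) h%:R ^+ m.*2.+1 * D (k - (l + m.+1).*2)%N ^+ 2.
  under eq_bigr do rewrite real_normK ?num_real //.
  by rewrite -mulr_sumr natrM -exprM muln2 exprS; ring.
rewrite -mulrA ler_wpM2l ?ler0n //.
pose w j := j%:R ^+ m.*2.+1 * D j ^+ 2.
have w0 j : 0 <= w j by rewrite mulr_ge0 ?sqr_ge0 ?exprn_ge0 ?ler0n.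
have d0 : 0 <= d.
  have kP : 0 < k%:R :> R by rewrite ltr0n; lia.
  by rewrite -(pmulr_lge0 _ kP); apply: le_trans hd; rewrite ler0n.
apply: (@le_trans _ _ ((2 * d) ^+ m.*2.+1 * \sum_(l < m.+1 * h) w (k - m.+1.*2 - l.*2)%N)).
  rewrite mulr_sumr; apply: ler_sum => l _; have lh := ltn_ord l.
  have -> : (k - m.+1.*2 - l.*2 = k - (l + m.+1).*2)%N by lia.
  rewrite /w mulrA ler_wpM2r ?sqr_ge0 // -exprMn; apply: lerXn2r; rewrite ?nnegrE ?ler0n //.
    by rewrite !mulr_ge0 ?ler0n.
  (* By [hk] all radii j that occur are at least k/2, hence h <= d k <= 2 d j. *)
  apply: le_trans hd _; rewrite [2 * d]mulrC -mulrA ler_wpM2l // -natrM ler_nat.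
  nia.
rewrite ler_wpM2l ?exprn_ge0 ?mulr_ge0 //.
have k8 : (8 * m.+1 <= k)%N by apply: leq_trans hk; rewrite leq_pmulr.
apply: le_trans (sum_stride2_le R w _ _ w0 _) _; first by nia.
have -> : (k - m.+1.*2).+1 = (k.+1 - m.+1.*2)%N by lia.
rewrite big_ltn; last by lia.
rewrite [w 0%N](_ : _ = 0) ?add0r //.
by rewrite /w mulr0n expr0n mul0r.
Qed.

(** * Antipodes and the size of exceptional sets *)

Lemma sphere_avg_antipode (R : realType) (N k : nat) (f : hypercube N -> R) (z : hypercube N) :
  (k <= N)%N -> sphere_avg R N f k z = sphere_avg R N f (N - k) (z + const_mx 1).
Proof.
move=> kN; rewrite /sphere_avg bin_sub //; congr (_ / _).
rewrite (reindex_inj (inv_inj (addr_involutive N (const_mx 1)))) /=.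
apply: eq_big => y; last by rewrite -addrA [y + _]addrC.
rewrite hweight_antipode; move: (hweight_le N y); move: (hweight y) => w wN.
by apply/idP/idP => /eqP ?; apply/eqP; lia.
Qed.

Lemma exists_good_antipodal (N : nat) (B : {set hypercube N}) :
  (4 * #|B| <= 2 ^ N)%N -> exists z, z \notin B /\ z + const_mx 1 \notin B.
Proof.
move=> HB; pose B' := [set x + const_mx 1 | x in B].
have cB' : #|B'| = #|B| by rewrite card_imset //; exact: inv_inj (addr_involutive N _).
have P0 : (0 < 2 ^ N)%N by rewrite expn_gt0.
have : (0 < #|~: (B :|: B')|)%N.
  have := cardsC (B :|: B'); rewrite card_hypercube.
  have := (leq_card_setU B B').1; rewrite cB'; lia.
case/card_gt0P => z; rewrite !inE negb_or => /andP[zB zB']; exists z; split=> //.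
apply: contra zB' => zB'; apply/imsetP; exists (z + const_mx 1) => //.
by rewrite addr_involutive.
Qed.

(** Four exceptional sets of density at most 1/16 have a union of density at most 1/4, as
    [exists_good_antipodal] demands. *)
Lemma card_le_of_weak_bound (R : realType) (c N : nat) (a t : R) :
  0 < t -> 16 * a <= t -> c%:R * t <= a * 2 ^+ N -> (16 * c <= 2 ^ N)%N.
Proof.
move=> t0 at0 H; rewrite -(ler_nat R) natrM natrX -(ler_pM2r t0).
have P0 : 0 < 2 ^+ N :> R by rewrite exprn_gt0.
have := ler_wpM2r (ltW P0) at0; lra.
Qed.

Lemma card_setU4_le (T : finType) (A B C D : {set T}) (n : nat) :
  (16 * #|A| <= n)%N -> (16 * #|B| <= n)%N -> (16 * #|C| <= n)%N ->
  (16 * #|D| <= n)%N -> (4 * #|A :|: B :|: C :|: D| <= n)%N.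
Proof.
have := (leq_card_setU (A :|: B :|: C) D).1; have := (leq_card_setU (A :|: B) C).1.
have := (leq_card_setU A B).1.
move: #|A| #|B| #|C| #|D| #|A :|: B| #|A :|: B :|: C| #|A :|: B :|: C :|: D|; lia.
Qed.

(** * The bound for radii up to N/2 *)

Lemma low_spheres_sparse (R : realType) (m : nat) : exists2 C : R, 0 < C &
  forall (N : nat) (f : hypercube N -> R) (e d l : R), (0 < N)%N ->
  (forall x, 0 <= f x <= 1) -> \sum_x f x = e * 2 ^+ N -> 0 < d -> 0 < l ->
  d * l = e -> d ^+ m.+1.*2 <= l -> 8 * m.+1%:R * d <= 1 ->
  exists B : {set hypercube N}, (4 * #|B| <= 2 ^ N)%N /\
    forall z k, z \notin B -> (k <= N./2)%N -> sphere_avg R N f k z <= C * l.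
Proof.
have [CE CE0 HE] := sphere_avg_energy R m.
(* [D] gathers the constant of [smoothing_bound] and the level of the square function, so that B^2
   <= D l^2; [CE + 1] is positive even if [CE] is 0. *)
pose D : R := m.+1%:R * 2 ^+ m.*2.+1 * (16 * (CE + 1)).
have D1 : 1 <= D.
  have p1 : 1 <= m.+1%:R * 2 ^+ m.*2.+1 :> R.
    by rewrite -[2]/(2%:R) -natrX -natrM ler1n muln_gt0 expn_gt0.
  have c1 : 1 <= 16 * (CE + 1) by lra.
  by rewrite /D -[leLHS]mulr1 ler_pM.
(* One summand each for the radii k < 1/d, the smoothed term and the remainder [B]. *)
exists (32 + 2 ^+ m.+1 * 512 + D).
  by have : 0 < 2 ^+ m.+1 :> R by [rewrite exprn_gt0]; lra.
move=> N f e d l N0 f01 fe d0 l0 dl dm dM.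
have halfN : (N./2.+1 <= N.+1)%N by have := odd_double_half N; lia.
have halfle : (N./2 <= N)%N by [].
have halfN32 : (16 * N./2.+1 <= 32 * N)%N by have := odd_double_half N; lia.
have f0 x : 0 <= f x by case/andP: (f01 x).
have e0 : 0 < e by rewrite -dl mulr_gt0.
have NP : 0 < N%:R :> R by rewrite ltr0n.
have TP : 0 < 2 ^+ N :> R by rewrite exprn_gt0.
pose A k z := sphere_avg R N f k z.
have A0 k z : 0 <= A k z by apply: sphere_avg_ge0.
pose S n z := \sum_(0 <= k < n) A k z.
have S0 n z : 0 <= S n z by apply: sumr_ge0.
have Ssum n : (n <= N.+1)%N -> \sum_z S n z = n%:R * e * 2 ^+ N.
  move=> nN; rewrite exchange_big /= big_nat_cond.
  rewrite (eq_bigr (fun=> e * 2 ^+ N)).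
    by rewrite -big_nat_cond sumr_const_nat subn0 -[_ *+ n]mulr_natl mulrA.
  by move=> k /andP[/andP[_ kn] _]; rewrite sum_sphere_avg ?fe // -ltnS (leq_trans kn).
have Smono n n' z : (n <= n')%N -> S n z <= S n' z.
  by move=> nn; rewrite /S [leRHS](big_cat_nat (n := n)) //= lerDl sumr_ge0.
pose K0 := minn (Num.truncn d^-1) N.
pose G z := \sum_(1 <= k < N./2.+1 - m.+1)
     k%:R ^+ m.*2.+1 * iter m.+1 (diff2 R) (fun j => A j z) k ^+ 2.
have G0 z : 0 <= G z.
  by apply: sumr_ge0 => k _; rewrite mulr_ge0 ?sqr_ge0 ?exprn_ge0 ?ler0n.
(* [B1] and [B2] control sums over radii up to N/8 and up to N/2, [B3] the radii below 1/d, [B4] the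
   square function. Each level is at least 16 times the bound on the mean. *)
pose B1 := [set z | [exists K : 'I_N, [&& (0 < K)%N, (8 * K <= N)%N &
     8 * K%:R * (16 * e) < S K.+1 z]]].
pose B2 := [set z | 32 * N%:R * e < S N./2.+1 z].
pose B3 := [set z | 32 * l < S K0.+1 z].
pose B4 := [set z | 16 * (CE + 1) * e < G z].
have b1 : (16 * #|B1| <= 2 ^ N)%N.
  apply: (@card_le_of_weak_bound R _ _ e (16 * e)) => //; first by rewrite mulr_gt0.
  by rewrite -fe; apply: cesaro_maximal.
have b2 : (16 * #|B2| <= 2 ^ N)%N.
  apply: (@card_le_of_weak_bound R _ _ (N./2.+1%:R * e) (32 * N%:R * e)).
  - by rewrite !mulr_gt0.
  - by rewrite mulrA ler_pM2r // -!natrM ler_nat.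
  - rewrite -Ssum //.
    exact: card_markov.
have b3 : (16 * #|B3| <= 2 ^ N)%N.
  apply: (@card_le_of_weak_bound R _ _ (K0.+1%:R * e) (32 * l)); first by rewrite mulr_gt0.
    have K0d : K0%:R <= d^-1.
      have di : 0 <= d^-1 by rewrite invr_ge0 ltW.
      have /andP[+ _] := truncn_itv di; apply: le_trans; rewrite ler_nat; exact: geq_minl.
    (* This gives K0 + 1 <= 2/d, so the mean of [S K0.+1] is at most 2l. *)
    have d1 : 1 <= d^-1.
      rewrite invf_ge1 //; apply: le_trans dM; rewrite ler_peMl ?(ltW d0) //.
      by rewrite -[8]/(8%:R) -natrM ler1n.
    rewrite mulrSr -dl.
    have dd : d^-1 * (d * l) = l by rewrite mulrA mulVf ?mul1r ?gt_eqF.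
    have : (K0%:R + 1) * (d * l) <= (d^-1 + d^-1) * (d * l).
      by rewrite ler_wpM2r ?lerD // ltW // mulr_gt0.
    rewrite [(d^-1 + _) * _]mulrDl dd; lra.
  rewrite -Ssum; last by rewrite ltnS /K0 geq_minr.
  exact: card_markov.
have b4 : (16 * #|B4| <= 2 ^ N)%N.
  apply: (@card_le_of_weak_bound R _ _ (CE * e) (16 * (CE + 1) * e)).
  - by rewrite !mulr_gt0 //; lra.
  - by rewrite mulrA ler_pM2r //; lra.
  - apply: le_trans (card_markov R _ G _ G0) _.
    apply: le_trans (HE N f) _; rewrite -mulrA ler_wpM2l // -fe.
    apply: ler_sum => x _; have /andP[x0 x1] := f01 x.
    by rewrite expr2 ler_piMl.
exists (B1 :|: B2 :|: B3 :|: B4); split.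
  exact: card_setU4_le.
move=> z k; rewrite 3!finset.in_setU !negb_or -!andbA => /and4P[zB1 zB2 zB3 zB4] kN.
have kN' := leq_trans kN halfle.
rewrite -/(A k z).
have pm0 : 0 < 2 ^+ m.+1 :> R by rewrite exprn_gt0.
have [dk|dk] := ltP (d * k%:R) 1.
  apply: (@le_trans _ _ (32 * l)); last by rewrite ler_pM2r //; lra.
  move: zB3; rewrite inE -leNgt; apply: le_trans.
  have kK0 : (k <= K0)%N.
    rewrite leq_min kN' andbT truncn_ge_nat ?invr_ge0 ?(ltW d0) //.
    by rewrite -(ler_pM2l d0) divff ?gt_eqF // ltW.
  apply: le_trans (Smono k.+1 K0.+1 z _); last by [].
  by rewrite /S big_nat_recr //= lerDr sumr_ge0.
(* As d k >= 1, [h] is at least 1 and at least d k / 2; 8(m+1) d <= 1 makes the windows fit below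
   k. *)
pose h := Num.truncn (d * k%:R).
have k0 : (0 < k)%N.
  by case: k dk {kN kN' h} => [|//]; rewrite mulr0 ler10.
have kP : 0 < k%:R :> R by rewrite ltr0n.
have dk0 : 0 <= d * k%:R by apply: le_trans dk.
have /andP[hle hlt] := truncn_itv dk0; rewrite -/h in hle hlt.
have h0 : (0 < h)%N by rewrite /h truncn_ge_nat.
have hP : 0 < h%:R :> R by rewrite ltr0n.
have hk : (8 * m.+1 * h <= k)%N.
  rewrite -(ler_nat R) natrM natrM.
  apply: (@le_trans _ _ (8 * m.+1%:R * (d * k%:R))); first by rewrite ler_wpM2l // mulr_ge0.
  by rewrite mulrA ler_piMl // ltW.
have [B [AB BB]] := smoothing_bound R (fun j => A j z) m k h d (fun j => A0 j z) h0 hle hk.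
apply: le_trans AB _; rewrite -/(S k.+1 z).
(* [B1] gives 128 k e when 8k <= N; otherwise [B2] gives 32 N e, and N < 8k. *)
have Sk : S k.+1 z <= 256 * k%:R * e.
  have [kN8|kN8] := leqP (8 * k) N.
    have kN'' : (k < N)%N by clear -k0 kN8; lia.
    move: zB1; rewrite inE => /existsPn/(_ (Ordinal kN'')) /=.
    rewrite k0 kN8 /= -leNgt => /le_trans; apply.
    have := mulr_gt0 kP e0; lra.
  apply: le_trans (Smono k.+1 N./2.+1 z _) _ => //.
  move: zB2; rewrite inE -leNgt => /le_trans; apply; rewrite ler_pM2r //.
  have : N%:R <= 8 * k%:R :> R by rewrite -[8]/(8%:R) -natrM ler_nat ltnW.
  lra.
have T1 : 2 ^+ m.+1 / h%:R * S k.+1 z <= 2 ^+ m.+1 * 512 * l.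
  rewrite -!mulrA ler_wpM2l ?(ltW pm0) // mulrC ler_pdivrMr //.
  apply: le_trans Sk _; rewrite -dl.
  have dkh : d * k%:R <= 2 * h%:R.
    have : 1 <= h%:R :> R by rewrite ler1n.
    move: hlt; rewrite mulrSr; lra.
  have := ler_wpM2r (ltW l0) dkh; lra.
(* Here d^(2m+1) e = d^(2m+2) l <= l^2, by the hypothesis [dm]. *)
have GB : B ^+ 2 <= D * l ^+ 2.
  apply: le_trans BB _.
  apply: (@le_trans _ _ (m.+1%:R * (2 * d) ^+ m.*2.+1 * G z)).
    rewrite ler_wpM2l ?mulr_ge0 ?ler0n ?exprn_ge0 ?mulr_ge0 ?(ltW d0) // /G.
    have [n1|n1] := leqP 1 (k.+1 - m.+1.*2); last first.
      rewrite big_geq; last exact: ltnW.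
      exact: G0.
    rewrite [leRHS](big_cat_nat (n := k.+1 - m.+1.*2)) //=; last by clear -kN; lia.
    rewrite lerDl sumr_ge0 // => j _.
    by rewrite mulr_ge0 ?sqr_ge0 ?exprn_ge0 ?ler0n.
  move: zB4; rewrite inE -leNgt => Gz.
  apply: (@le_trans _ _ (m.+1%:R * (2 * d) ^+ m.*2.+1 * (16 * (CE + 1) * e))).
    by rewrite ler_wpM2l ?mulr_ge0 ?ler0n ?exprn_ge0 ?mulr_ge0 ?(ltW d0).
  have -> : m.+1%:R * (2 * d) ^+ m.*2.+1 * (16 * (CE + 1) * e) = D * l * d ^+ m.+1.*2.
    rewrite /D -dl exprMn doubleS [d ^+ m.*2.+2]exprS; ring.
  rewrite expr2 mulrA ler_wpM2l // mulr_ge0 ?(ltW l0) //; lra.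
have Bl : B <= D * l.
  have Dl0 : 0 <= D * l by rewrite mulr_ge0 ?(ltW l0) //; lra.
  have [B0|/ltW B0] := leP 0 B; last exact: le_trans B0 Dl0.
  rewrite -(@ler_pXn2r _ 2) ?nnegrE // exprMn; apply: le_trans GB _.
  by rewrite ler_wpM2r ?sqr_ge0 // expr2 ler_peMl //; lra.
by rewrite !mulrDl -addrA addrC; apply: le_trans (lerD T1 Bl) _; have := l0; lra.
Qed.

(** * From indicator functions to the theorem *)

Lemma density_sphere_avg (R : realType) (N k : nat) (L : {set hypercube N}) (z : hypercube N) :
  #|[set x in L | hweight (x - z) == k]|%:R / #|sphere z k|%:R
    = sphere_avg R N (fun x => (x \in L)%:R) k z.
Proof.
rewrite /sphere_avg; congr (_ / _%:R).
  rewrite [RHS](reindex_inj (addrI (- z))) /= -sum1_card natr_sum big_mkcond [RHS]big_mkcond.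
  apply: eq_bigr => x _; rewrite !inE addrA subrr add0r [- z + x]addrC.
  by case: (x \in L); case: ifP.
rewrite -card_hweight /sphere -(card_imset _ (addrI z)); congr #|pred_of_set _|.
apply/setP => x; rewrite inE; apply/idP/imsetP => [xk|[y + ->]].
  by exists (x - z); rewrite ?inE // addrC subrK.
by rewrite inE addrC addKr.
Qed.

Theorem corollary2p6 (R : realType) (p : R) (hp : 1 < p) :
  exists eps C : R, 0 < eps /\ 0 < C /\
    forall (N : nat), (1 <= N)%N ->
    forall L : {set hypercube N}, reldensity R L <= eps ->
    exists z : hypercube N, forall k : nat, (k <= N)%N ->
      #|[set x in L | hweight (x - z) == k]|%:R / #|sphere z k|%:R
        <= C * (reldensity R L) `^ (1 / p).
Proof.
have p1 : 0 < p - 1 by rewrite subr_gt0.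
have p0 : 0 < p by apply: lt_trans hp.
have q0 : 0 < 1 - 1 / p by rewrite subr_gt0 ltr_pdivrMr // mul1r.
(* This makes (2m+2)(1 - 1/p) >= 1/p, hence d^(2m+2) <= l since e <= 1. *)
have [m Hm] : exists m : nat, 1 <= m.+1%:R * (p - 1).
  exists (Num.truncn (p - 1)^-1).
  have pi : 0 <= (p - 1)^-1 by rewrite invr_ge0 ltW.
  have /andP[_ H] := truncn_itv pi.
  by rewrite -ler_pdivrMr // mul1r ltW.
have [C C0 HC] := low_spheres_sparse R m.
pose a : R := (8 * m.+1%:R)^-1.
have a0 : 0 < a by rewrite invr_gt0 mulr_gt0 // ltr0n.
(* The threshold says d = e^(1-1/p) <= a, that is 8(m+1) d <= 1. *)
exists (a `^ (1 - 1 / p)^-1), C; split; first exact: powR_gt0.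
split=> // N N1 L; set e := reldensity R L => ea.
have TP : 0 < 2 ^+ N :> R by rewrite exprn_gt0.
have eT : e * 2 ^+ N = #|L|%:R by rewrite /e /reldensity divfK ?gt_eqF.
have e0 : 0 <= e by rewrite divr_ge0 ?ler0n // ltW.
(* Empty [L] is set apart, as d and l must be positive below. *)
move: e0; rewrite le_eqVlt => /orP[/eqP e0|e0].
  exists 0 => k _; move: eT; rewrite -e0 mul0r => /esym/eqP.
  rewrite pnatr_eq0 cards_eq0 => /eqP ->.
  have -> : [set x in finset.set0 | hweight (x - 0 : hypercube N) == k] = finset.set0.
    by apply/setP => x; rewrite !inE.
  by rewrite cards0 mul0r mulr_ge0 ?powR_ge0 // ltW.
pose f (x : hypercube N) : R := (x \in L)%:R.
have f01 x : 0 <= f x <= 1 by rewrite /f; case: (x \in L); rewrite /= ?ler01 ?lexx.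
have fe : \sum_x f x = e * 2 ^+ N.
  by rewrite eT -sum1_card natr_sum [RHS]big_mkcond; apply: eq_bigr => x _; rewrite /f; case: (x \in L).
pose l := e `^ (1 / p); pose d := e `^ (1 - 1 / p).
have l0 : 0 < l by exact: powR_gt0.
have d0 : 0 < d by exact: powR_gt0.
have dl : d * l = e.
  rewrite /d /l -powRD ?subrK ?powRr1 ?(ltW e0) //.
  by apply/implyP => _; rewrite gt_eqF.
have e1 : e <= 1.
  by rewrite -(ler_pM2r TP) eT mul1r -natrX ler_nat -card_hypercube max_card.
have dm : d ^+ m.+1.*2 <= l.
  rewrite /d /l -powR_mulrn ?powR_ge0 // -powRrM.
  apply: ger_powR; first by rewrite e0 e1.
  rewrite ler_pdivrMr // mulrAC.
  have -> : (1 - 1 / p) * p = p - 1 by field; rewrite gt_eqF.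
  by rewrite mulrC -addnn natrD mulrDl -[leLHS]addr0 lerD // mulr_ge0 ?ler0n // ltW.
have dM : 8 * m.+1%:R * d <= 1.
  rewrite -ler_pdivlMl ?mulr_gt0 ?ltr0n // mulr1 -/a.
  have -> : a = (a `^ (1 - 1 / p)^-1) `^ (1 - 1 / p).
    by rewrite -powRrM mulVf ?gt_eqF // powRr1 // ltW.
  by apply: ge0_ler_powR; rewrite ?nnegrE ?powR_ge0 // ltW.
have [B [cB HB]] := HC N f e d l N1 f01 fe d0 l0 dl dm dM.
have [z [zB zB']] := exists_good_antipodal N B cB.
exists z => k kN; rewrite density_sphere_avg -/f -/l.
(* A radius above N/2 around z is a radius below N/2 around its antipode, which is good too. *)
have [k2|k2] := leqP k N./2; first exact: HB.
rewrite sphere_avg_antipode //; apply: HB => //.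
by clear -k2 kN; have := odd_double_half N; lia.
Qed.
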